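(* Let $\mathbf{k}$ be an algebraically closed field of characteristic $0$, let $F\in\mathbf{k}[x_1,\dots,x_6]$ be a general enough homogeneous cubic, and let $I=F^\perp+S_{\ge3}\subseteq S=\mathbf{k}[\alpha_1,\dots,\alpha_6]$. Then the negative spike at $[I]\in\mathcal{B}\subseteq\mathrm{Hilb}^{13}_{\mathbb{A}^6/\mathbf{k}}$ is isomorphic, as a scheme over $\mathbf{k}$, to $\mathrm{Spec}(S/F^\perp)$.
   Context: Apolarity: $S=\mathbf{k}[\alpha_1,\dots,\alpha_6]$ acts on $\mathbf{k}[x_1,\dots,x_6]$ with $\alpha_i$ acting as $\frac{\partial}{\partial x_i}$; write $f\lrcorner p$ for this action, $ev_F(f)=f\lrcorner F$, and $F^\perp=\{f\in S: f\lrcorner F=0\}$. A homogeneous cubic $F$ in $x_1,\dots,x_6$ is general enough if: (1) $F,\frac{\partial F}{\partial x_1},\dots,\frac{\partial F}{\partial x_6},x_1,\dots,x_6,1$ are linearly independent, so form a basis of $\mathrm{im}(ev_F)$ (in particular $[F^\perp]\in\mathrm{Hilb}^{14}_{\mathbb{A}^6/\mathbf{k}}$); (2) the minimal graded free resolution of the $S$-module $F^\perp$ starts with $0\leftarrow F^\perp\leftarrow S^{\oplus15}(-2)\leftarrow S^{\oplus35}(-3)\leftarrow\cdots$; (3) $[F^\perp]$ has trivial negative tangents, i.e. $\dim_{\mathbf{k}}\mathrm{Hom}_S(F^\perp,S/F^\perp)_{<0}=6$ (degree $k$ homomorphisms raise degree by $k$). Hilbert scheme: $\mathcal{H}=\mathrm{Hilb}^{13}_{\mathbb{A}^6/\mathbf{k}}$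 is the scheme whose $A$-points $[J]$ are ideals $J\subseteq S_A=A[\alpha_1,\dots,\alpha_6]$ such that $S_A/J$ is a finite flat $A$-module of rank $13$. $\mathbb{G}_m$ acts on $\mathcal{H}$ via scaling on $\mathbb{A}^6$: for $a\in A^*$, $a\cdot[J]$ is the ideal $\ker(S_A\to S_A\to S_A/J)$, where the first map is $\alpha_i\mapsto a\alpha_i$. Barycenter scheme: $Bar:\mathcal{H}\to\mathbb{A}^6$ is the Hilbert–Chow morphism followed by averaging of $13$ points; on an $A$-point given by a free $A$-algebra $R=S_A/J$ it is $\alpha_j\mapsto\frac1{13}\mathrm{Tr}_{R/A}(\alpha_j)$. $\mathcal{B}=Bar^{-1}(0)$, a $\mathbb{G}_m$-stable closed subscheme containing $[I]$ as a $\mathbb{G}_m$-fixed point. $\mathcal{B}^+$ is the scheme representing $T\mapsto\{\mathbb{G}_m\text{-equivariant } \mathbb{A}^1\times T\to\mathcal{B}\}$ ($\mathbb{G}_m$ acting by multiplication on $\mathbb{A}^1$ and trivially on $T$), and $\pi:\mathcal{B}^+\to\mathcal{B}^{\mathbb{G}_m}$ is restriction to $0\times T$. The negative spike at the $\mathbb{G}_m$-fixed point $[I]$ is the scheme-theoretic fiber $\pi^{-1}([I])$. *)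

(* Defs.v *)
From HB Require Import structures.
From mathcomp Require Import all_boot all_order all_algebra.
From mathcomp Require Import generic_quotient ring_quotient.
From mathcomp Require Import boolp ssrcomplements mpoly.

Set Implicit Arguments.
Unset Strict Implicit.
Unset Printing Implicit Defensive.

Import GRing.Theory.
Local Open Scope ring_scope.
Local Open Scope quotient_scope.

(* The library's [idealr] only covers proper ideals, *)
(* whereas an ideal generated by a set may be the unit ideal; its quotient  *)
(* is then the zero ring, whence [comPzRingType].                           *)
(* Ideals are compared with [=i].                                           *)

Record ideal (R : comNzRingType) := Ideal {
  ideal_pred :> {pred R};
  ideal0 : 0 \in ideal_pred;
  ideal_lin : forall a, {in ideal_pred &, forall u v, a * u + v \in ideal_pred}
}.

Section IdealQuotient.
Variables (R : comNzRingType) (J : ideal R).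

Lemma idealM a u : u \in J -> a * u \in J.
Proof. by move=> uJ; rewrite -[a * u]addr0 ideal_lin ?ideal0. Qed.

Lemma ideal_zmod_closed : zmod_closed (ideal_pred J).
Proof.
split=> [|u v uJ vJ]; first exact: ideal0.
by rewrite -mulN1r addrC ideal_lin.
Qed.

HB.instance Definition _ :=
  GRing.isZmodClosed.Build R (ideal_pred J) ideal_zmod_closed.

Definition quot := Quotient.quot (ideal_pred J).

HB.instance Definition _ := GRing.Zmodule.on quot.

Definition proj (x : R) : quot := \pi_(Quotient.quot (ideal_pred J)) x.

Lemma proj_zmod_morphism : zmod_morphism proj.
Proof. by move=> x y; rewrite /proj !piE. Qed.

HB.instance Definition _ :=
  GRing.isZmodMorphism.Build R quot proj proj_zmod_morphism.

Definition lift_quot (q : quot) : R := repr (q : Quotient.quot (ideal_pred J)).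

Lemma lift_quotK q : proj (lift_quot q) = q.
Proof. exact: reprK. Qed.

Lemma projE x y : (proj x == proj y) = (x - y \in J).
Proof. by rewrite /proj -Quotient.idealrBE. Qed.

Definition quot_one : quot := proj 1.
Definition quot_mul (x y : quot) : quot := proj (lift_quot x * lift_quot y).

Lemma proj_mul : {morph proj : x y / x * y >-> quot_mul x y}.
Proof.
move=> x y; apply/eqP; rewrite projE.
have J1 z : z - lift_quot (proj z) \in J by rewrite -projE lift_quotK.
have -> : x * y - lift_quot (proj x) * lift_quot (proj y) =
  y * (x - lift_quot (proj x)) + lift_quot (proj x) * (y - lift_quot (proj y)).
  by rewrite !mulrBr [y * x]mulrC [y * lift_quot _]mulrC addrA subrK.
by rewrite ideal_lin ?idealM.
Qed.

Lemma quot_mulA : associative quot_mul.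
Proof.
move=> x y z; rewrite -[x]lift_quotK -[y]lift_quotK -[z]lift_quotK.
by rewrite -!proj_mul mulrA.
Qed.

Lemma quot_mulC : commutative quot_mul.
Proof.
move=> x y; rewrite -[x]lift_quotK -[y]lift_quotK.
by rewrite -!proj_mul mulrC.
Qed.

Lemma quot_mul1 : left_id quot_one quot_mul.
Proof. by move=> x; rewrite -[x]lift_quotK -proj_mul mul1r. Qed.

Lemma quot_mulDl : left_distributive quot_mul +%R.
Proof.
move=> x y z; rewrite -[x]lift_quotK -[y]lift_quotK -[z]lift_quotK.
by rewrite -raddfD -!proj_mul mulrDl raddfD.
Qed.

HB.instance Definition _ := GRing.Zmodule_isComPzRing.Build quot
  quot_mulA quot_mulC quot_mul1 quot_mulDl.

Lemma proj_monoid_morphism : monoid_morphism proj.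
Proof. by split=> // x y; rewrite proj_mul. Qed.

HB.instance Definition _ :=
  GRing.isMonoidMorphism.Build R quot proj proj_monoid_morphism.

End IdealQuotient.

Section IdealConstructions.
Variables (R R' : comNzRingType).

Definition ideal_span_pred (P : R -> Prop) : {pred R} :=
  [pred x | `[< forall K : ideal R, (forall y, P y -> y \in K) -> x \in K >]].

Lemma ideal_span0 P : 0 \in ideal_span_pred P.
Proof. by apply/asboolP => K _; apply: ideal0. Qed.

Lemma ideal_span_lin P a :
  {in ideal_span_pred P &, forall u v, a * u + v \in ideal_span_pred P}.
Proof.
move=> u v /asboolP uP /asboolP vP; apply/asboolP => K PK.
by rewrite ideal_lin ?uP ?vP.
Qed.

Definition ideal_span P := Ideal (ideal_span0 P) (@ideal_span_lin P).

Definition ideal_sum (J K : ideal R) :=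
  ideal_span (fun x => exists y z, [/\ y \in J, z \in K & x = y + z]).

Definition ideal_preim_pred (f : {rmorphism R -> R'}) (J : ideal R') : {pred R} :=
  [pred x | f x \in J].

Lemma ideal_preim0 f J : 0 \in ideal_preim_pred f J.
Proof. by rewrite inE rmorph0 ideal0. Qed.

Lemma ideal_preim_lin f J a :
  {in ideal_preim_pred f J &, forall u v, a * u + v \in ideal_preim_pred f J}.
Proof. by move=> u v; rewrite !inE => uJ vJ; rewrite rmorphD rmorphM ideal_lin. Qed.

Definition ideal_preim f J := Ideal (ideal_preim0 f J) (@ideal_preim_lin f J).

End IdealConstructions.

(* [phi : A -> Q] is the structure map of an A-algebra Q.                   *)

Section FiniteFlat.
Variables (A : comNzRingType) (Q : comPzRingType) (phi : A -> Q).

Definition generates d (e : 'I_d -> Q) : Prop :=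
  forall x, exists c : 'I_d -> A, x = \sum_i phi (c i) * e i.

Definition is_basis d (e : 'I_d -> Q) : Prop :=
  generates e /\
  forall c : 'I_d -> A, \sum_i phi (c i) * e i = 0 -> forall i, c i = 0.

Definition finite_alg : Prop := exists d (e : 'I_d -> Q), generates e.

Definition bilinear_alg (N P : lmodType A) (b : Q -> N -> P) : Prop :=
  [/\ forall x y n, b (x + y) n = b x n + b y n,
      forall x n m, b x (n + m) = b x n + b x m,
      forall a x n, b (phi a * x) n = a *: b x n
    & forall a x n, b x (a *: n) = a *: b x n].

(* The element \sum_(z <- s) z.1 (x) z.2 of Q (x)_A N is zero; the tensor   *)
(* product enters through its universal property.                           *)
Definition tensor_eq0 (N : lmodType A) (s : seq (Q * N)) : Prop :=
  forall (P : lmodType A) (b : Q -> N -> P), bilinear_alg b ->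
    \sum_(z <- s) b z.1 z.2 = 0.

(* id (x) u : Q (x)_A N -> Q (x)_A N' is injective whenever u is. *)
Definition flat_alg : Prop :=
  forall (N N' : lmodType A) (u : {linear N -> N'}), injective u ->
  forall s : seq (Q * N),
    tensor_eq0 [seq (z.1, u z.2) | z <- s] -> tensor_eq0 s.

End FiniteFlat.


Section HilbertScheme.
Variable n : nat.
Implicit Types A B : comNzRingType.

Definition str A (J : ideal {mpoly A[n]}) (a : A) : quot J := proj J a%:MP.

(* Pull-back of [J] along Spec B -> Spec A: the extended ideal J S_B, with  *)
(* S_B / J S_B = (S_A / J) (x)_A B.                                         *)
Definition base_change A B (g : {rmorphism A -> B}) (J : ideal {mpoly A[n]}) :
    ideal {mpoly B[n]} :=
  ideal_span (fun y => exists2 p, p \in J & y = map_mpoly g p).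

(* The rank is d at every field-valued point of Spec A, in particular at    *)
(* every residue field.                                                     *)
Definition hilb_point d A (J : ideal {mpoly A[n]}) : Prop :=
  [/\ finite_alg (str J),
      flat_alg (str J)
    & forall (K : fieldType) (g : {rmorphism A -> K}),
        exists e : 'I_d -> quot (base_change g J),
          is_basis (str (base_change g J)) e].

Definition scale_tuple A (a : A) : n.-tuple {mpoly A[n]} :=
  [tuple a *: 'X_i | i < n].

Definition Gm_act A (a : A) (J : ideal {mpoly A[n]}) : ideal {mpoly A[n]} :=
  ideal_preim (comp_mpoly (scale_tuple a)) J.

(* A point over A[t] is a morphism x : A^1 x Spec A -> Hilb.  A B-point of  *)
(* A^1 x Spec A is a ring morphism h : A[t] -> B, and the translate by a in *)
(* B^* of that point is the morphism h' which agrees with h on A and sends  *)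
(* t to a h(t); equivariance is x(h') = a . x(h) for all B, h and a.        *)
Definition Gm_equivariant A (J : ideal {mpoly {poly A}[n]}) : Prop :=
  forall B (a b : B) (h h' : {rmorphism {poly A} -> B}),
    a * b = 1 -> (forall c, h' c%:P = h c%:P) -> h' 'X = a * h 'X ->
    base_change h' J =i Gm_act a (base_change h J).

Definition at_zero A : {rmorphism {poly A} -> A} := horner_eval (0 : A).

End HilbertScheme.


Record kalg (k : fieldType) := KAlg {
  kalg_car :> comNzRingType;
  kalg_str : {rmorphism k -> kalg_car}
}.

Section KAlgebras.
Variables (k : fieldType) (n : nat).

Definition kalg_poly (A : kalg k) : kalg k :=
  KAlg (polyC \o kalg_str A : {rmorphism k -> {poly A}}).

Definition kalg_morph (A B : kalg k) (g : {rmorphism A -> B}) : Prop :=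
  forall c, g (kalg_str A c) = kalg_str B c.

Definition poly_map (A B : kalg k) (g : {rmorphism A -> B}) :
  {rmorphism {poly A} -> {poly B}} := map_poly g.

(* [c] is the image of the point [J] of Hilb^d under Bar.  Over an A-algebra*)
(* B on which S_A / J becomes free, [M] is the matrix of multiplication by  *)
(* alpha_j in a basis, so that \tr M = Tr(alpha_j); such B cover Spec A,    *)
(* hence these equations determine [c].                                     *)
Definition is_barycenter d (A : kalg k) (J : ideal {mpoly A[n]})
    (c : 'I_n -> A) : Prop :=
  forall (B : comNzRingType) (g : {rmorphism A -> B})
         (e : 'I_d -> quot (base_change g J)),
    is_basis (str (base_change g J)) e ->
  forall (j : 'I_n) (M : 'M[B]_d),
    (forall i, proj (base_change g J) 'X_j * e i
               = \sum_l str (base_change g J) (M i l) * e l) ->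
    g (c j) = g (kalg_str A d%:R^-1) * \tr M.

(* A-points of the closed subscheme Bar^-1(0) of Hilb^d. *)
Definition centered_point d (A : kalg k) (J : ideal {mpoly A[n]}) : Prop :=
  hilb_point d J /\ is_barycenter d J (fun=> 0).

(* A-points of the fiber of (Bar^-1(0))^+ -> (Bar^-1(0))^Gm over the        *)
(* k-point [I]: Gm-equivariant morphisms A^1 x Spec A -> Bar^-1(0) whose    *)
(* restriction to 0 x Spec A is [I], pulled back to A.                      *)
Definition negative_spike_point d (I : ideal {mpoly k[n]}) (A : kalg k)
    (J : ideal {mpoly {poly A}[n]}) : Prop :=
  [/\ centered_point d (A := kalg_poly A) J,
      Gm_equivariant J
    & base_change (at_zero A) J =i base_change (kalg_str A) I].

Record Spec_quot_point (K : ideal {mpoly k[n]}) (A : kalg k) := SpecQuotPoint {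
  spec_mor :> {rmorphism quot K -> A};
  spec_morK : forall c : k, spec_mor (str K c) = kalg_str A c
}.

End KAlgebras.

(* An isomorphism of k-schemes from Spec (S / K) to the negative spike at   *)
(* [I], given on functors of points: a bijection from the A-points of the   *)
(* source onto those of the target, natural in the k-algebra A.             *)
Record Spec_iso_negative_spike (k : fieldType) n d (K I : ideal {mpoly k[n]}) :=
  SpecIsoNegativeSpike {
  iso_fun : forall A : kalg k, Spec_quot_point K A -> ideal {mpoly {poly A}[n]};
  iso_in_spike : forall (A : kalg k) (f : Spec_quot_point K A),
    negative_spike_point d I (iso_fun f);
  iso_inj : forall (A : kalg k) (f f' : Spec_quot_point K A),
    iso_fun f =i iso_fun f' <-> f =1 f';
  iso_surj : forall (A : kalg k) (J : ideal {mpoly {poly A}[n]}),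
    negative_spike_point d I J -> exists f : Spec_quot_point K A, iso_fun f =i J;
  iso_natural : forall (A B : kalg k) (g : {rmorphism A -> B}),
    kalg_morph g ->
    forall (f : Spec_quot_point K A) (f' : Spec_quot_point K B),
    f' =1 g \o f -> iso_fun f' =i base_change (poly_map g) (iso_fun f)
}.

(* The same type {mpoly k[n]} serves for the ring S and for the *)
(* polynomials in x_1, ..., x_n on which S acts.                            *)

Section Apolarity.
Variables (k : fieldType) (n : nat).
Local Notation S := {mpoly k[n]}.
Implicit Types (f g p F : S).

Definition apolar f p : S := \sum_(m <- msupp f) f@_m *: p^`M[m].

Lemma apolarwE d f p : (msize f <= d)%N ->
  apolar f p = \sum_(m : 'X_{1..n < d}) f@_m *: p^`M[m].
Proof.
move=> led; rewrite /apolar (big_mksub 'X_{1..n < d}) /=; first last.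
- by move=> m /msize_mdeg_lt/leq_trans; apply.
- exact: msupp_uniq.
by rewrite big_rmcond //= => m; move/memN_msupp_eq0 ->; rewrite scale0r.
Qed.

Definition ev F f : S := apolar f F.

Lemma ev_is_linear F : linear (ev F).
Proof.
move=> a f g; pose d := maxn (msize (a *: f + g)) (maxn (msize f) (msize g)).
rewrite /ev !(@apolarwE d) ?leq_max ?leqnn ?orbT //.
rewrite scaler_sumr -big_split /=; apply: eq_bigr => m _.
by rewrite mcoeffD mcoeffZ scalerDl scalerA.
Qed.

HB.instance Definition _ F := GRing.isLinear.Build k S S _ (ev F) (ev_is_linear F).

Lemma evX F m : ev F 'X_[m] = F^`M[m].
Proof. by rewrite /ev /apolar msuppX big_seq1 mcoeffX eqxx scale1r. Qed.

Lemma apolar0 f : apolar f 0 = 0.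
Proof. by rewrite /apolar big1 // => m _; rewrite raddf0 scaler0. Qed.

Lemma evXM F m g : ev F ('X_[m] * g) = (ev F g)^`M[m].
Proof.
rewrite {1}[g]mpolyE mulr_sumr raddf_sum [ev F g]/ev /apolar.
rewrite raddf_sum /=; apply: eq_bigr => m' _.
by rewrite -scalerAr linearZ /= -mpolyXD evX addmC mderivmDm mderivmZ.
Qed.

Lemma evM F f g : ev F (f * g) = ev (ev F g) f.
Proof.
elim/mpolyind: f => [|c m f _ _ IHf]; first by rewrite mul0r !raddf0.
by rewrite mulrDl !raddfD /= IHf -scalerAl !linearZ /= evXM evX.
Qed.

Definition perp_pred F : {pred S} := [pred f | ev F f == 0].

Lemma perp0 F : 0 \in perp_pred F.
Proof. by rewrite inE raddf0. Qed.

Lemma perp_lin F a :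
  {in perp_pred F &, forall u v, a * u + v \in perp_pred F}.
Proof.
move=> u v; rewrite !inE => /eqP uF /eqP vF.
by rewrite raddfD /= evM uF vF addr0 /ev apolar0.
Qed.

Definition perp F : ideal S := Ideal (perp0 F) (@perp_lin F).

Definition Sge_pred d : {pred S} :=
  [pred f : S | all (fun m => (d <= mdeg m)%N) (msupp f)].

Lemma Sge0 d : 0 \in Sge_pred d.
Proof. by rewrite inE msupp0. Qed.

Lemma Sge_lin d a : {in Sge_pred d &, forall u v, a * u + v \in Sge_pred d}.
Proof.
move=> u v; rewrite !inE => /allP ud /allP vd; apply/allP => m /msuppD_le.
rewrite mem_cat => /orP[/msuppM_le/allpairsP[[m1 m2] /= [_ /ud dm2 ->]]|/vd //].
by rewrite mdegD (leq_trans dm2) // leq_addl.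
Qed.

Definition Sge d : ideal S := Ideal (Sge0 d) (@Sge_lin d).

(* Homomorphisms of S-modules K -> S / K are represented by functions on S  *)
(* of which only the values on K matter.                                    *)
Definition is_hom (K : ideal S) (u : S -> quot K) : Prop :=
  forall a, {in K &, forall f g, u (a * f + g) = proj K a * u f + u g}.

Definition quot_homog (K : ideal S) (e : int) (x : quot K) : Prop :=
  exists2 p : S, x = proj K p & all (fun m => (mdeg m)%:Z == e) (msupp p).

Definition hom_deg (K : ideal S) (e : int) (u : S -> quot K) : Prop :=
  is_hom u /\
  forall d f, f \in K -> f \is d.-homog -> quot_homog (d%:Z + e) (u f).

(* u lies in the sum of the Hom_S(K, S / K)_e over e < 0. *)
Definition hom_neg (K : ideal S) (u : S -> quot K) : Prop :=
  exists N (v : 'I_N -> S -> quot K),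
    (forall i : 'I_N, hom_deg (- i.+1%:Z) (v i)) /\
    {in K, forall f, u f = \sum_i v i f}.

Definition dim_hom_neg (K : ideal S) (r : nat) : Prop :=
  exists v : 'I_r -> S -> quot K,
  [/\ forall i, hom_neg (v i),
      forall c : 'I_r -> k,
        {in K, forall f, \sum_i str K (c i) * v i f = 0} -> forall i, c i = 0
    & forall u, hom_neg u -> exists c : 'I_r -> k,
        {in K, forall f, u f = \sum_i str K (c i) * v i f}].

(* The minimal graded free resolution of K starts with                      *)
(* 0 <- K <- S(-2)^b0 <- S(-3)^b1: q consists of the images of the basis    *)
(* vectors of S(-2)^b0, hence of quadrics, and s is the matrix of the next  *)
(* map, hence has linear entries.  Minimality says that the kernels of the  *)
(* two maps lie in (alpha_1, ..., alpha_n) times their sources.             *)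
Definition resolution_starts (K : ideal S) (b0 b1 : nat) : Prop :=
  exists (q : 'cV[S]_b0) (s : 'M[S]_(b1, b0)),
  [/\ (forall i, q i 0 \is 2.-homog) /\ (forall j i, s j i \is 1.-homog),
      forall f, f \in K <-> exists c : 'rV[S]_b0, f = (c *m q) 0 0,
      forall c : 'rV[S]_b0, c *m q = 0 <-> exists d : 'rV[S]_b1, c = d *m s,
      forall c : 'rV[S]_b0, c *m q = 0 -> forall i, (c 0 i)@_0%MM = 0
    & forall d : 'rV[S]_b1, d *m s = 0 -> forall j, (d 0 j)@_0%MM = 0].

Definition derivs_free F : Prop :=
  forall (a : k) (b c : 'I_n -> k) (d : k),
    a *: F + \sum_i b i *: F^`M(i) + \sum_i c i *: 'X_i + d%:MP = 0 ->
  [/\ a = 0, forall i, b i = 0, forall i, c i = 0 & d = 0].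

End Apolarity.

Definition general_enough (k : fieldType) (F : {mpoly k[6]}) : Prop :=
  [/\ F \is 3.-homog, derivs_free F,
      resolution_starts (perp F) 15 35 & dim_hom_neg (perp F) 6].

(* Main.v *)
Require Import Defs.
From HB Require Import structures.
From mathcomp Require Import all_boot all_order all_algebra.
From mathcomp Require Import mpoly.
From mathcomp Require Import generic_quotient ring_quotient boolp ring.

Set Implicit Arguments.
Unset Strict Implicit.
Unset Printing Implicit Defensive.

Import GRing.Theory.
Local Open Scope ring_scope.

(** Why the theorem is true.  Write n for the number of variables; the quotient
    S / perp F is a graded Gorenstein algebra with Hilbert function (1, n, n, 1),
    and I cuts out the quotient by its socle, of rank 2n + 1.

    A point of the negative spike over A is a flat ideal of A[t][alpha], homogeneous
    when t has degree 1 ([equivariant_hpart]) and without t-torsion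
    ([flat_torsion_free]).  It is therefore the homogenization of its fibre U over
    t = 1 ([equivariant_determined]), and U is any ideal of S_A with the same
    leading forms as I and barycenter 0.

    The classification of these U is [leading_forms_spike].  Lift the quadrics
    generating perp F to elements of U.  Their corrections of degree 1 respect
    the linear syzygies modulo perp F; since the syzygies are generated by the
    linear ones, they form a homomorphism perp F -> S / perp F of degree -1
    ([syzygy_hom]).  The n derivations are linearly independent homomorphisms of
    negative degree ([field_preserving_perp]), hence span all of them, and a
    translation removes the corrections of degree 1.  The remaining
    constants form a homomorphism of degree -2, which is zero.  So a
    translate of U contains perp F, and its image in S_A / perp F is a line spanned
    by a lift of the socle ([leading_forms_residual]).  The variables act on this line
    by scalars a_l; these are the coordinates of an A-point a of
    Spec (S / perp F), and the translate of U is the ideal residual to a, consisting of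
    the p such that p (alpha_l - a_l) lies in perp F for all l.

    Conversely each point a has a residual ideal, generated by perp F and the
    element representing evaluation at a in the Gorenstein pairing
    ([residual_gen]), so its formation commutes with base change
    ([base_change_residual]); its quotient is free of rank 2n + 1.  On S / perp F
    the variables are nilpotent, so the trace of alpha_l on the residual quotient is
    - a_l ([spike_trace]).  Hence exactly one translate has barycenter 0, that by
    a / (2n + 1), and the points of the spike correspond to the points a.  For
    t a instead of a this gives the family over the line ([spike_family]). *)

(** * Ideals and their base change *)

Section Ideals.
Variable R : comNzRingType.
Implicit Types J K : ideal R.

Lemma idealD J x y : x \in J -> y \in J -> x + y \in J.
Proof. by move=> xJ yJ; rewrite -[x]mul1r ideal_lin. Qed.

Lemma idealN J x : x \in J -> - x \in J.
Proof. by move=> xJ; rewrite -mulN1r idealM. Qed.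

Lemma idealB J x y : x \in J -> y \in J -> x - y \in J.
Proof. by move=> xJ yJ; rewrite idealD ?idealN. Qed.

Lemma ideal_sum_in (I : Type) (r : seq I) (P : pred I) (f : I -> R) J :
  (forall i, P i -> f i \in J) -> \sum_(i <- r | P i) f i \in J.
Proof.
by move=> fJ; elim/big_ind: _ => //; [exact: ideal0 | exact: idealD].
Qed.

Lemma mem_ideal_span (P : R -> Prop) x : P x -> x \in ideal_span P.
Proof. by move=> Px; apply/asboolP => K; apply. Qed.

Lemma ideal_span_min (P : R -> Prop) K :
  (forall y, P y -> y \in K) -> {subset ideal_span P <= K}.
Proof. by move=> PK x /asboolP; apply. Qed.

Lemma mem_proj0 J x : (proj J x == 0) = (x \in J).
Proof. by rewrite -[0](raddf0 (proj J)) projE subr0. Qed.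

End Ideals.

Lemma mem_ideal_preim (R R' : comNzRingType) (f : {rmorphism R -> R'})
    (J : ideal R') x : (x \in ideal_preim f J) = (f x \in J).
Proof. by []. Qed.

Section BaseChange.
Variables (n : nat) (A B : comNzRingType) (g : {rmorphism A -> B}).
Implicit Types J : ideal {mpoly A[n]}.

Lemma mem_base_change J p : p \in J -> map_mpoly g p \in base_change g J.
Proof. by move=> pJ; apply: mem_ideal_span; exists p. Qed.

Lemma base_change_min J (K : ideal {mpoly B[n]}) :
  (forall p, p \in J -> map_mpoly g p \in K) ->
  {subset base_change g J <= K}.
Proof. by move=> JK; apply: ideal_span_min => y [p /JK pK ->]. Qed.

Lemma mpolyZ_in (K : ideal {mpoly A[n]}) (c : A) p : p \in K -> c *: p \in K.
Proof. by move=> pK; rewrite -mul_mpolyC idealM. Qed.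

Lemma eq_base_change J J' : J =i J' -> base_change g J =i base_change g J'.
Proof.
by move=> eqJ y; apply/idP/idP; apply: base_change_min => p pJ;
  apply: mem_base_change; rewrite ?eqJ // -eqJ.
Qed.

Lemma map_mpoly_onto (s : B -> A) :
  cancel s g -> forall y : {mpoly B[n]}, exists p, y = map_mpoly g p.
Proof.
move=> sK y; exists (\sum_(m <- msupp y) s y@_m *: 'X_[m]).
rewrite rmorph_sum {1}[y]mpolyE; apply: eq_bigr => m _.
by rewrite /= map_mpolyZ sK map_mpolyX.
Qed.

(** Along a surjection the extended ideal is the mere image, since the image
    is already stable under multiplication. *)
Lemma base_change_onto (s : B -> A) J y : cancel s g ->
  y \in base_change g J -> exists2 p, p \in J & y = map_mpoly g p.
Proof.
move=> sK.
pose im : {pred {mpoly B[n]}} :=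
  [pred z | `[< exists2 p, p \in J & z = map_mpoly g p >]].
have im0 : 0 \in im by apply/asboolP; exists 0; rewrite ?ideal0 ?rmorph0.
have im_lin a : {in im &, forall u v, a * u + v \in im}.
  move=> u v /asboolP[p pJ ->] /asboolP[q qJ ->]; apply/asboolP.
  have [b ->] := map_mpoly_onto sK a.
  by exists (b * p + q); rewrite ?ideal_lin // rmorphD rmorphM.
suff sub: {subset base_change g J <= Ideal im0 im_lin}.
  by move=> /sub/asboolP.
by apply: base_change_min => p pJ; apply/asboolP; exists p.
Qed.

End BaseChange.

Lemma map_mpoly_id n (A : comNzRingType) (p : {mpoly A[n]}) :
  map_mpoly idfun p = p.
Proof. by apply/mpolyP => m; rewrite mcoeff_map_mpoly. Qed.

Lemma map_mpoly_compE n (A B C : comNzRingType) (g : {rmorphism A -> B})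
    (h : {rmorphism B -> C}) (l : {rmorphism A -> C}) (p : {mpoly A[n]}) :
  (forall c, l c = h (g c)) -> map_mpoly h (map_mpoly g p) = map_mpoly l p.
Proof. by move=> lE; apply/mpolyP => m; rewrite !mcoeff_map_mpoly /= lE. Qed.

Lemma meval_map_mpoly n (A B : comNzRingType) (g : {rmorphism A -> B})
    (p : {mpoly A[n]}) r r' : (forall i, r' i = g (r i)) ->
  (map_mpoly g p).@[r'] = g p.@[r].
Proof.
move=> rE; elim/mpolyind: p => [|c m p _ _ IHp]; first by rewrite !rmorph0.
rewrite !rmorphD /= IHp; congr (_ + _).
rewrite map_mpolyZ map_mpolyX !mevalZ rmorphM /= !mevalX rmorph_prod.
by congr (_ * _); apply: eq_bigr => i _; rewrite rE rmorphXn.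
Qed.

Lemma base_change_id n (A : comNzRingType) (J : ideal {mpoly A[n]}) :
  base_change idfun J =i J.
Proof.
move=> p; apply/idP/idP => [|pJ]; last by rewrite -[p]map_mpoly_id mem_base_change.
by apply: base_change_min => q; rewrite map_mpoly_id.
Qed.

(** * Contraction against the cubic *)

Section Contract.
Variables (k : fieldType) (n : nat) (F : {mpoly k[n]}).

(** [weight m] is the constant term of the derivative of [F] by [m], so that
    [contract p] is the constant term of [p] acting on [F]: the functional whose
    pairing [p, q |-> contract (p * q)] makes S / perp F a Gorenstein algebra.
    Summing over the support of [F], rather than over that of [p], makes the
    linearity in [p] and the compatibility with base change immediate. *)
Definition weight m : k := (F^`M[m])@_0%MM.

Section OverRing.
Variables (A : comNzRingType) (i : {rmorphism k -> A}).

Definition contract (p : {mpoly A[n]}) : A :=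
  \sum_(m <- msupp F) i (weight m) * p@_m.

Lemma contract_scalar : scalar contract.
Proof.
move=> a p q; rewrite /contract mulr_sumr -big_split /=; apply: eq_bigr => m _.
by rewrite mcoeffD mcoeffZ mulrDr mulrCA.
Qed.

HB.instance Definition _ :=
  GRing.isLinear.Build A {mpoly A[n]} A _ contract contract_scalar.

Lemma weight_supp m : m \notin msupp F -> weight m = 0.
Proof.
by move=> mF; rewrite /weight mcoeff_mderivm addm0 memN_msupp_eq0 // mul0rn.
Qed.

Lemma contractX m : contract 'X_[m] = i (weight m).
Proof.
rewrite /contract; have [mF|mF] := boolP (m \in msupp F).
  rewrite (bigD1_seq m) ?msupp_uniq //= mcoeffX eqxx mulr1 big1 ?addr0 //.
  by move=> m' /negPf nm; rewrite mcoeffX eq_sym nm mulr0.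
rewrite weight_supp // rmorph0 big_seq big1 // => m' m'F.
rewrite mcoeffX; case: eqP => [mE|_]; last by rewrite mulr0.
by rewrite mE m'F in mF.
Qed.

Lemma contractZ c p : contract (c *: p) = c * contract p.
Proof. exact: linearZ. Qed.

Lemma contract0 : contract 0 = 0.
Proof. exact: raddf0. Qed.

Lemma contractD p q : contract (p + q) = contract p + contract q.
Proof. exact: raddfD. Qed.

Lemma contractB p q : contract (p - q) = contract p - contract q.
Proof. exact: raddfB. Qed.

Lemma contract_sum (I : Type) (r : seq I) (P : pred I) (f : I -> {mpoly A[n]}) :
  contract (\sum_(x <- r | P x) f x) = \sum_(x <- r | P x) contract (f x).
Proof. exact: raddf_sum. Qed.

Lemma contractE p : contract p = \sum_(m <- msupp p) p@_m * i (weight m).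
Proof.
rewrite {1}[p]mpolyE linear_sum; apply: eq_bigr => m _.
by rewrite linearZ /= contractX.
Qed.

End OverRing.

Lemma contract_map (A B : comNzRingType) (i : {rmorphism k -> A})
    (j : {rmorphism k -> B}) (g : {rmorphism A -> B}) p :
  (forall c, j c = g (i c)) ->
  contract j (map_mpoly g p) = g (contract i p).
Proof.
move=> jE; rewrite /contract rmorph_sum; apply: eq_bigr => m _.
by rewrite mcoeff_map_mpoly rmorphM /= jE.
Qed.

Lemma contract_ev f : contract idfun f = (ev F f)@_0%MM.
Proof.
rewrite contractE /ev /apolar raddf_sum /=; apply: eq_bigr => m _.
by rewrite mcoeffZ.
Qed.

Hypothesis char0 : [pchar k] =i pred0.

Lemma nat_neq0 d : d.+1%:R != 0 :> k.
Proof. by move/pcharf0P: char0 => ->. Qed.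

Lemma contractMX_ev f m : contract idfun (f * 'X_[m]) =
  (ev F f)@_m *+ \prod_(i < n) (m i)`!.
Proof.
rewrite contract_ev mulrC evXM mcoeff_mderivm addm0; congr (_ *+ _).
by apply: eq_bigr => j _; rewrite ffactnn.
Qed.

(** A polynomial over [k] is recovered, in characteristic zero, from the values
    at 0 of its derivatives: so [perp F] is the kernel of the pairing
    [f, g |-> contract (f * g)]. *)
Lemma perp_contractP f :
  reflect (forall g, contract idfun (f * g) = 0) (f \in perp F).
Proof.
apply: (iffP idP) => [/eqP fF g|f0].
  by rewrite contract_ev mulrC evM fF /ev apolar0 mcoeff0.
apply/eqP/mpolyP => m; rewrite mcoeff0; apply/eqP.
have /eqP := f0 'X_[m]; rewrite contractMX_ev -mulr_natr mulf_eq0 => /orP[//|].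
have : (0 < \prod_(i < n) (m i)`!)%N by apply: prodn_gt0 => i; apply: fact_gt0.
by case: (\prod_(i < n) _)%N => // d _; rewrite (negPf (nat_neq0 d)).
Qed.

End Contract.
Arguments contract {k n} F {A} i p.

(** * Degrees and homogeneous components *)

Lemma msize_leP n (R : comNzRingType) (p : {mpoly R[n]}) d :
  reflect (forall m, (d <= mdeg m)%N -> p@_m = 0) (msize p <= d)%N.
Proof.
apply: (iffP idP) => [pd m dm|p0].
  by apply/memN_msupp_eq0/msize_mdeg_ge; apply: leq_trans pd dm.
rewrite msizeE; apply/bigmax_leqP_seq => m mp _; rewrite ltnNge.
by apply: contraTN mp => /p0 pm; rewrite mcoeff_msupp pm eqxx.
Qed.

Lemma dhomog_map (n d : nat) (A B : comNzRingType) (g : {rmorphism A -> B})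
    (p : {mpoly A[n]}) :
  p \is d.-homog -> map_mpoly g p \is d.-homog.
Proof.
move=> /dhomogP p_hom; apply/dhomogP => m; rewrite mcoeff_msupp mcoeff_map_mpoly.
case: (boolP (m \in msupp p)) => [/p_hom //|/memN_msupp_eq0 ->].
by rewrite raddf0 eqxx.
Qed.

Lemma mcoeff_pihomog (n d : nat) (A : comNzRingType) (p : {mpoly A[n]}) m :
  (pihomog mdeg d p)@_m = if mdeg m == d then p@_m else 0.
Proof.
elim/mpolyind: p => [|c m' p _ _ IHp]; first by rewrite !raddf0 if_same.
rewrite !raddfD /= IHp linearZ /= pihomogX.
have -> : (c *: (if mdeg m' == d then 'X_[m'] else 0))@_m
    = if mdeg m == d then (c *: 'X_[A, m'])@_m else 0 :> A.
  rewrite !mcoeffZ mcoeffX; have [<-|nm] := eqVneq m' m.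
    by case: ifP => _; rewrite ?mcoeffX ?eqxx // mcoeff0 mulr0.
  rewrite mulr0 if_same; case: ifP => _; last by rewrite mcoeff0 mulr0.
  by rewrite mcoeffX (negPf nm) mulr0.
by case: ifP => _; rewrite ?addr0.
Qed.

(** * The graded algebra S / perp F and its dual bases *)

Section Cubic.
Variables (k : fieldType) (n : nat) (F : {mpoly k[n]}).
Hypothesis char0 : [pchar k] =i pred0.
Hypothesis cubicF : F \is 3.-homog.

Lemma weight_deg m : mdeg m != 3%N -> weight F m = 0.
Proof.
by move=> m3; apply: weight_supp; apply: contraNN m3 => /(dhomogP _ _ _ cubicF)/= ->.
Qed.

Section OverRing.
Variables (A : comNzRingType) (i : {rmorphism k -> A}).
Implicit Types p g : {mpoly A[n]}.

Lemma contract_no3 p : (forall m, mdeg m = 3%N -> p@_m = 0) -> contract F i p = 0.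
Proof.
move=> p0; rewrite contractE big1 // => m _.
have [/p0 ->|/weight_deg ->] := eqVneq (mdeg m) 3%N; first by rewrite mul0r.
by rewrite rmorph0 mulr0.
Qed.

Lemma contract_dhomog d p : p \is d.-homog -> d != 3%N -> contract F i p = 0.
Proof.
move=> p_hom d3; apply: contract_no3 => m m3; apply: dhomog_nemf_coeff p_hom _.
by rewrite /= m3 eq_sym.
Qed.

Lemma contract_msize p : (msize p <= 3)%N -> contract F i p = 0.
Proof.
move=> p3; apply: contract_no3 => m m3; apply/memN_msupp_eq0/msize_mdeg_ge.
by rewrite /= m3.
Qed.

Definition annih_pred : {pred {mpoly A[n]}} :=
  [pred p | `[< forall g, contract F i (p * g) = 0 >]].

Lemma annih0 : 0 \in annih_pred.
Proof. by apply/asboolP => g; rewrite mul0r contract0. Qed.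

Lemma annih_lin a : {in annih_pred &, forall u v, a * u + v \in annih_pred}.
Proof.
move=> u v /asboolP u0 /asboolP v0; apply/asboolP => g.
by rewrite mulrDl contractD -mulrA mulrCA u0 v0 addr0.
Qed.

(** The extension of [perp F] to [A], described as the kernel of the pairing
    because this makes membership a system of [A]-linear equations. *)
Definition annih := Ideal annih0 annih_lin.

Lemma annihP p : reflect (forall g, contract F i (p * g) = 0) (p \in annih).
Proof. exact: asboolP. Qed.

Lemma annihXP p :
  (forall m, contract F i (p * 'X_[m]) = 0) -> p \in annih.
Proof.
move=> p0; apply/annihP => g; rewrite [g]mpolyE mulr_sumr contract_sum big1 // => m _.
by rewrite -scalerAr contractZ p0 mulr0.
Qed.

Lemma annih_map f : f \in perp F -> map_mpoly i f \in annih.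
Proof.
move=> /(perp_contractP F char0) f0; apply: annihXP => m.
by rewrite -(map_mpolyX i) -rmorphM /= (@contract_map _ _ _ _ _ idfun) // f0 rmorph0.
Qed.

Lemma annih_deg4 p : (forall m, m \in msupp p -> (3 < mdeg m)%N) -> p \in annih.
Proof.
move=> p4; apply: annihXP => m; apply: contract_no3 => m' m'3.
apply/memN_msupp_eq0; apply/negP => /msuppM_le /allpairsP[[m1 m2] /= [m1p]].
rewrite msuppX inE => /eqP -> m'E; move: (p4 _ m1p).
by rewrite ltnNge -m'3 m'E mdegD leq_addr.
Qed.

End OverRing.

(** In the pairing, [1], the variables, [b] and [s] form a basis of S / perp F
    whose dual basis is [s], [b], the variables and [1]. *)
Definition dual_bases (b : 'I_n -> {mpoly k[n]}) (s : {mpoly k[n]}) : Prop :=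
  [/\ forall j, b j \is 2.-homog,
      forall l j, contract F idfun ('X_l * b j) = (l == j)%:R,
      s \is 3.-homog & contract F idfun s = 1].

Hypothesis freeF : derivs_free F.

(** The functionals [contract (alpha_l * _)], for l < n, are linearly
    independent since the first derivatives of [F] are; so a dual family of
    quadrics exists. *)
Lemma exists_dual_quadrics : exists b : 'I_n -> {mpoly k[n]},
  (forall j, b j \is 2.-homog) /\
  forall l j, contract F idfun ('X_l * b j) = (l == j)%:R.
Proof.
(* The monomials of bounded degree form a finite type; the quadratic part of the
   solution is extracted afterwards. *)
pose T : finType := 'X_{1..n < 4}.
pose mon (x : 'I_#|T|) : 'X_{1..n} := val (enum_val x).
pose M : 'M[k]_(n, #|T|) := \matrix_(l, x) weight F (U_(l) + mon x)%MM.
have contr_deriv c m :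
    (\sum_l c l *: F^`M(l))@_m *+ \prod_(j < n) (m j)`!
      = \sum_l c l * weight F (U_(l) + m)%MM.
  rewrite raddf_sum /= -sumrMnl; apply: eq_bigr => l _.
  rewrite /weight mderivmDm mderivmU1m mcoeffZ mcoeff_mderivm addm0.
  rewrite -mulrnAr; congr (_ * (_ *+ _)).
  by apply: eq_bigr => j _; rewrite ffactnn.
have M_free : row_free M.
  apply: inj_row_free => c cM0; apply/rowP => l; rewrite mxE.
  suff D0 : \sum_l c 0 l *: F^`M(l) = 0.
    have [] := freeF (a := 0) (b := fun l => c 0 l) (c := fun=> 0) (d := 0).
      by rewrite D0 scale0r !addr0 add0r big1 ?addr0 // => j _; rewrite scale0r.
    by move=> _ /(_ l).
  apply/mpolyP => m; rewrite mcoeff0.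
  have fact0 : (\prod_(j < n) (m j)`!)%:R != 0 :> k.
    have : (0 < \prod_(j < n) (m j)`!)%N by apply: prodn_gt0 => j; apply: fact_gt0.
    by case: (\prod_(j < n) _)%N => // d _; rewrite (nat_neq0 char0).
  apply: (mulIf fact0); rewrite mul0r mulr_natr (contr_deriv (fun l => c 0 l)).
  have [m4|m4] := ltnP (mdeg m) 4; last first.
    rewrite big1 // => j _; rewrite weight_deg ?mulr0 // mdegD mdeg1.
    by rewrite gtn_eqF // ltnW // ltnS ltnW.
  move/rowP/(_ (enum_rank (BMultinom m4))): cM0; rewrite !mxE => cM0m.
  rewrite -[RHS]cM0m; apply: eq_bigr => j _.
  by rewrite mxE /mon enum_rankK.
pose P := pinvmx M.
have MP : M *m P = 1%:M by rewrite mulmxVp.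
exists (fun j => pihomog mdeg 2 (\sum_x P x j *: 'X_[mon x])); split => [j|l j].
  exact: pihomogP.
(* The other homogeneous components are orthogonal to the variables. *)
transitivity (contract F idfun ('X_l * \sum_x P x j *: 'X_[mon x])).
  apply/eqP; rewrite -subr_eq0 -contractB -mulrBr; apply/eqP.
  apply: contract_no3 => m m3; set q := \sum_x _.
  apply/memN_msupp_eq0/negP => /msuppM_le /allpairsP[[m1 m2] /= []].
  rewrite msuppX inE => /eqP -> + mE; move: m3; rewrite mE mdegD mdeg1 add1n => -[m2E].
  by rewrite mcoeff_msupp mcoeffB mcoeff_pihomog m2E eqxx subrr eqxx.
move/matrixP/(_ l j): MP; rewrite !mxE => <-.
rewrite mulr_sumr contract_sum; apply: eq_bigr => x _ /=.
by rewrite -scalerAr contractZ -mpolyXD contractX [M _ _]mxE mulrC.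
Qed.

Lemma exists_socle : exists s : {mpoly k[n]},
  s \is 3.-homog /\ contract F idfun s = 1.
Proof.
have F0 : F != 0.
  apply/eqP => F0; have [] := freeF (a := 1) (b := fun=> 0) (c := fun=> 0) (d := 0).
    rewrite F0 scaler0 add0r !big1 ?addr0 // => j _; exact: scale0r.
  by move/eqP; rewrite oner_eq0.
have mF := mlead_supp F0; set m := mlead F in mF.
have w0 : weight F m != 0.
  rewrite /weight mcoeff_mderivm addm0 -mulr_natr mulf_neq0 // -?mcoeff_msupp //.
  have : (0 < \prod_(j < n) (m j)^_(m j))%N.
    by apply: prodn_gt0 => j; rewrite ffactnn; apply: fact_gt0.
  by case: (\prod_(j < n) _)%N => // d _; rewrite (nat_neq0 char0).
exists ((weight F m)^-1 *: 'X_[m]); split.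
  by apply: dhomogZ; rewrite dhomogX (dhomogP _ _ _ cubicF).
by rewrite contractZ contractX mulVf.
Qed.

Lemma exists_dual_bases : exists b s, dual_bases b s.
Proof.
have [b [b2 bP]] := exists_dual_quadrics.
by have [s [s3 sP]] := exists_socle; exists b, s.
Qed.

End Cubic.
Arguments annih {k n} F {A} i.

(** * Residual ideals of points *)

Section Residual.
Variables (k : fieldType) (n : nat) (F : {mpoly k[n]}).
Variables (A : comNzRingType) (i : {rmorphism k -> A}).
Variable r : 'I_n -> A.
Implicit Types p g : {mpoly A[n]}.

Definition residual_pred : {pred {mpoly A[n]}} :=
  [pred p | `[< forall g, contract F i (p * g) = contract F i p * g.@[r] >]].

Lemma residual0 : 0 \in residual_pred.
Proof. by apply/asboolP => g; rewrite mul0r contract0 mul0r. Qed.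

Lemma residual_lin a : {in residual_pred &, forall u v, a * u + v \in residual_pred}.
Proof.
move=> u v /asboolP uE /asboolP vE; apply/asboolP => g.
rewrite mulrDl !contractD -mulrA mulrCA uE vE [a * u]mulrC uE mevalM.
by rewrite mulrDl mulrA.
Qed.

(** The ideal residual to the point [r] in the scheme of [perp F]: its members
    are the [p] with [p * (alpha_l - r l)] in [annih F i] for all [l]. *)
Definition residual := Ideal residual0 residual_lin.

Lemma residualP p : reflect
  (forall g, contract F i (p * g) = contract F i p * g.@[r]) (p \in residual).
Proof. exact: asboolP. Qed.

Lemma residualXP p :
  (forall m, contract F i (p * 'X_[m]) = contract F i p * 'X_[m].@[r]) ->
  p \in residual.
Proof.
move=> pE; apply/residualP => g; rewrite [g]mpolyE mulr_sumr contract_sum.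
rewrite rmorph_sum mulr_sumr; apply: eq_bigr => m _ /=.
by rewrite -scalerAr contractZ pE mevalZ mulrCA.
Qed.

Lemma annih_residual p : p \in annih F i -> p \in residual.
Proof.
move=> /annihP p0; apply/residualP => g; rewrite p0.
by have := p0 1; rewrite mulr1 => ->; rewrite mul0r.
Qed.

End Residual.
Arguments residual {k n} F {A} i r.

Lemma sum_delta (A : comNzRingType) n (c : 'I_n -> A) j :
  \sum_l c l * (l == j)%:R = c j.
Proof.
rewrite (bigD1 j) //= eqxx mulr1 big1 ?addr0 // => l /negPf ->.
by rewrite mulr0.
Qed.

Section DualBases.
Variables (k : fieldType) (n : nat) (F : {mpoly k[n]}).
Hypothesis char0 : [pchar k] =i pred0.
Hypothesis cubicF : F \is 3.-homog.
Variables (b : 'I_n -> {mpoly k[n]}) (s : {mpoly k[n]}).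
Hypothesis bsP : dual_bases F b s.
Variables (A : comNzRingType) (i : {rmorphism k -> A}).
Implicit Types p g : {mpoly A[n]}.

Let bA l : {mpoly A[n]} := map_mpoly i (b l).
Let sA : {mpoly A[n]} := map_mpoly i s.

Let bA_homog l : bA l \is 2.-homog.
Proof. by apply: dhomog_map; case: bsP. Qed.

Let sA_homog : sA \is 3.-homog.
Proof. by apply: dhomog_map; case: bsP. Qed.

Let X_homog l : 'X_l \is [in A[n], 1.-homog].
Proof. by rewrite dhomogX /= mdeg1. Qed.

Let contract_homog d p : p \is d.-homog -> d != 3%N -> contract F i p = 0.
Proof. exact: contract_dhomog. Qed.

Definition comb (c0 : A) (c1 c2 : 'I_n -> A) (c3 : A) : {mpoly A[n]} :=
  c0%:MP + \sum_l c1 l *: 'X_l + \sum_l c2 l *: bA l + c3 *: sA.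

Let contract_Xb l j : contract F i ('X_l * bA j) = (l == j)%:R.
Proof.
rewrite -(map_mpolyX i) -rmorphM (contract_map F (i := idfun)) //.
by case: bsP => _ -> _ _; rewrite rmorph_nat.
Qed.

Let contract_s : contract F i sA = 1.
Proof.
by rewrite (contract_map F (i := idfun)) //; case: bsP => _ _ _ ->; rewrite rmorph1.
Qed.

Lemma contract_combM c0 c1 c2 c3 g : contract F i (comb c0 c1 c2 c3 * g) =
  c0 * contract F i g + \sum_l c1 l * contract F i ('X_l * g)
  + \sum_l c2 l * contract F i (bA l * g) + c3 * contract F i (sA * g).
Proof.
rewrite !mulrDl !contractD mul_mpolyC contractZ -scalerAl contractZ.
by rewrite !mulr_suml !contract_sum; congr (_ + _ + _ + _);
  apply: eq_bigr => l _; rewrite -scalerAl contractZ.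
Qed.

Lemma contract_comb c0 c1 c2 c3 : contract F i (comb c0 c1 c2 c3) = c3.
Proof.
rewrite -[comb _ _ _ _]mulr1 contract_combM !mulr1 contract_s mulr1.
rewrite (contract_homog (dhomog1 _ _)) // mulr0 add0r !big1 ?add0r // => l _.
  by rewrite mulr1 (contract_homog (bA_homog l)) ?mulr0.
by rewrite mulr1 (contract_homog (X_homog l)) ?mulr0.
Qed.

Lemma contract_combX c0 c1 c2 c3 j :
  contract F i (comb c0 c1 c2 c3 * 'X_j) = c2 j.
Proof.
rewrite contract_combM (contract_homog (X_homog j)) // mulr0 add0r.
rewrite (contract_homog (dhomogM sA_homog (X_homog j))) // mulr0 addr0.
rewrite big1 ?add0r => [|l _]; last first.
  by rewrite (contract_homog (dhomogM (X_homog l) (X_homog j))) ?mulr0.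
rewrite (eq_bigr (fun l => c2 l * (l == j)%:R)) ?sum_delta ?addr0 // => l _.
by rewrite [bA l * _]mulrC contract_Xb eq_sym.
Qed.

Lemma contract_combb c0 c1 c2 c3 j :
  contract F i (comb c0 c1 c2 c3 * bA j) = c1 j.
Proof.
rewrite contract_combM (contract_homog (bA_homog j)) // mulr0 add0r.
rewrite (contract_homog (dhomogM sA_homog (bA_homog j))) // mulr0 addr0.
rewrite [X in _ + X]big1 ?addr0 => [|l _]; last first.
  by rewrite (contract_homog (dhomogM (bA_homog l) (bA_homog j))) ?mulr0.
rewrite (eq_bigr (fun l => c1 l * (l == j)%:R)) ?sum_delta // => l _.
by rewrite contract_Xb.
Qed.

Lemma contract_combs c0 c1 c2 c3 : contract F i (comb c0 c1 c2 c3 * sA) = c0.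
Proof.
rewrite contract_combM contract_s mulr1.
rewrite (contract_homog (dhomogM sA_homog sA_homog)) // mulr0 addr0.
rewrite !big1 ?addr0 // => l _.
  by rewrite (contract_homog (dhomogM (bA_homog l) sA_homog)) ?mulr0.
by rewrite (contract_homog (dhomogM (X_homog l) sA_homog)) ?mulr0.
Qed.

(** Pairing with an element of the dual basis computes a coordinate. *)
Definition reduce p := comb (contract F i (p * sA))
  (fun l => contract F i (p * bA l)) (fun l => contract F i (p * 'X_l))
  (contract F i p).

Lemma comb_lin a c0 c1 c2 c3 d0 d1 d2 d3 :
  a *: comb c0 c1 c2 c3 + comb d0 d1 d2 d3 =
  comb (a * c0 + d0) (fun l => a * c1 l + d1 l) (fun l => a * c2 l + d2 l)
    (a * c3 + d3).
Proof.
rewrite /comb; move: (sA) (bA) => t w; rewrite !scalerDr !scaler_sumr.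
rewrite addrACA [X in X + _ = _]addrACA [X in X + _ + _ = _]addrACA.
rewrite -!big_split /= mpolyCD.
congr (_ + _ + _ + _); last by rewrite scalerA -scalerDl.
- by rewrite -mul_mpolyC -mpolyCM.
- by apply: eq_bigr => l _; rewrite scalerA -scalerDl.
by apply: eq_bigr => l _; rewrite scalerA -scalerDl.
Qed.

Lemma eq_comb c0 c1 c2 c3 d0 d1 d2 d3 :
  c0 = d0 -> c1 =1 d1 -> c2 =1 d2 -> c3 = d3 ->
  comb c0 c1 c2 c3 = comb d0 d1 d2 d3.
Proof.
by move=> -> c1E c2E ->; rewrite /comb; congr (_ + _ + _ + _);
  apply: eq_bigr => l _; rewrite ?c1E ?c2E.
Qed.

Lemma reduce_lin a p q : reduce (a *: p + q) = a *: reduce p + reduce q.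
Proof.
rewrite /reduce comb_lin; apply: eq_comb => [|l|l|];
  by rewrite ?mulrDl ?contractD -?scalerAl ?contractZ.
Qed.

Lemma comb0 : comb 0 (fun=> 0) (fun=> 0) 0 = 0.
Proof.
by rewrite /comb mpolyC0 scale0r !big1 ?addr0 // => l _; rewrite scale0r.
Qed.

Lemma reduce0 p : p \in annih F i -> reduce p = 0.
Proof.
move=> /annihP p0; rewrite -comb0 /reduce.
apply: eq_comb => [|l|l|]; rewrite ?p0 //.
by have := p0 1; rewrite mulr1.
Qed.

(** In each degree the pairing with the dual basis element kills the remainder;
    the remainder is then orthogonal to all monomials for degree reasons. *)
Let reduceX m : 'X_[m] - reduce 'X_[m] \in annih F i.
Proof.
have X_hom : 'X_[A, m] \is (mdeg m).-homog by rewrite dhomogX.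
case dm : (mdeg m) X_hom => [|[|[|[|d]]]] X_hom.
- have -> : m = 0%MM by apply/eqP; rewrite -mdeg_eq0 dm.
  have -> : reduce 'X_[0] = 'X_[0].
    rewrite mpolyX0 /reduce (@eq_comb _ _ _ _ 1 (fun=> 0) (fun=> 0) 0).
    - by rewrite /comb !big1 ?addr0 ?scale0r ?addr0 // => l _; rewrite scale0r.
    - by rewrite mul1r.
    - by move=> l; rewrite mul1r (contract_homog (bA_homog l)).
    - by move=> l; rewrite mul1r (contract_homog (X_homog l)).
    by rewrite (contract_homog (dhomog1 _ _)).
  by rewrite subrr ideal0.
- have /mdeg1P[j /eqP mE] : mdeg m == 1%N by rewrite dm.
  have -> : reduce 'X_[m] = 'X_[m].
    rewrite /reduce (@eq_comb _ _ _ _ 0 (fun l => (l == j)%:R) (fun=> 0) 0).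
    - rewrite /comb mpolyC0 add0r scale0r addr0 [X in _ + X]big1 ?addr0.
        rewrite (bigD1 j) //= eqxx scale1r big1 ?addr0 ?mE // => l /negPf ->.
        by rewrite scale0r.
      by move=> l _; rewrite scale0r.
    - by rewrite (contract_homog (dhomogM X_hom sA_homog)).
    - by move=> l; rewrite mE contract_Xb eq_sym.
    - by move=> l; rewrite (contract_homog (dhomogM X_hom (X_homog l))).
    by rewrite (contract_homog X_hom).
  by rewrite subrr ideal0.
- have redE : reduce 'X_[m] = \sum_l contract F i ('X_[m] * 'X_l) *: bA l.
    rewrite /reduce (@eq_comb _ _ _ _ 0 (fun=> 0)
      (fun l => contract F i ('X_[m] * 'X_l)) 0) //.
    - by rewrite /comb mpolyC0 scale0r add0r addr0 big1 ?add0r // => l _; rewrite scale0r.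
    - by rewrite (contract_homog (dhomogM X_hom sA_homog)).
    - by move=> l; rewrite (contract_homog (dhomogM X_hom (bA_homog l))).
    by rewrite (contract_homog X_hom).
  have rem_hom : 'X_[m] - reduce 'X_[m] \is 2.-homog.
    by rewrite rpredB ?X_hom // redE rpred_sum // => l _; apply: rpredZ; apply: bA_homog.
  apply: annihXP => m'.
  have Xm'_hom : 'X_[A, m'] \is (mdeg m').-homog by rewrite dhomogX.
  have [dm'|dm'] := eqVneq (mdeg m') 1%N; last first.
    by rewrite (contract_homog (dhomogM rem_hom Xm'_hom)) ?(eqn_add2l 2 _ 1).
  have /mdeg1P[j /eqP ->] : mdeg m' == 1%N by rewrite dm'.
  by rewrite mulrBl contractB contract_combX subrr.
- have redE : reduce 'X_[m] = contract F i 'X_[m] *: sA.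
    rewrite /reduce (@eq_comb _ _ _ _ 0 (fun=> 0) (fun=> 0) (contract F i 'X_[m])) //.
    - by rewrite /comb mpolyC0 !big1 ?add0r // => l _; rewrite scale0r.
    - by rewrite (contract_homog (dhomogM X_hom sA_homog)).
    - by move=> l; rewrite (contract_homog (dhomogM X_hom (bA_homog l))).
    by move=> l; rewrite (contract_homog (dhomogM X_hom (X_homog l))).
  have rem_hom : 'X_[m] - reduce 'X_[m] \is 3.-homog.
    by rewrite rpredB ?X_hom // redE; apply: rpredZ.
  apply: annihXP => m'.
  have Xm'_hom : 'X_[A, m'] \is (mdeg m').-homog by rewrite dhomogX.
  have [dm'|dm'] := eqVneq (mdeg m') 0%N; last first.
    by rewrite (contract_homog (dhomogM rem_hom Xm'_hom)) ?(eqn_add2l 3 _ 0).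
  have -> : m' = 0%MM by apply/eqP; rewrite -mdeg_eq0 dm'.
  by rewrite mpolyX0 mulr1 contractB contract_comb subrr.
have Xm0 : 'X_[A, m] \in annih F i.
  by apply: annih_deg4 => // m'; rewrite msuppX inE => /eqP ->; rewrite dm.
by rewrite reduce0 ?subr0.
Qed.

(** [S / perp F] has rank 2n + 2 over any base, with the same basis. *)
Lemma reduceP p : p - reduce p \in annih F i.
Proof.
elim/mpolyind: p => [|c m p _ _ IHp]; first by rewrite reduce0 ?subrr ?ideal0.
rewrite reduce_lin opprD addrACA -scalerBr.
by rewrite idealD // mpolyZ_in // reduceX.
Qed.

Lemma annih_pairP p : contract F i p = 0 ->
  (forall l, contract F i (p * 'X_l) = 0) ->
  (forall l, contract F i (p * bA l) = 0) -> contract F i (p * sA) = 0 ->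
  p \in annih F i.
Proof.
move=> p0 pX pb ps; rewrite -[p]subr0 -[X in _ - X]comb0.
have -> : comb 0 (fun=> 0) (fun=> 0) 0 = reduce p by apply: eq_comb.
exact: reduceP.
Qed.

End DualBases.

(** * Substitutions *)

Lemma eq_mpoly_rmorph n (A : comNzRingType) (B : comPzRingType)
    (f g : {rmorphism {mpoly A[n]} -> B}) :
  (forall c, f c%:MP = g c%:MP) -> (forall l, f 'X_l = g 'X_l) -> f =1 g.
Proof.
move=> fgC fgX p; rewrite [p]mpolyE !rmorph_sum /=; apply: eq_bigr => m _.
rewrite -mul_mpolyC !rmorphM /= fgC mpolyXE_id !rmorph_prod; congr (_ * _).
by apply: eq_bigr => l _; rewrite !rmorphXn fgX.
Qed.

Section Shift.
Variables (n : nat) (A : comNzRingType).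
Implicit Types (v w : 'I_n -> A) (p : {mpoly A[n]}).

Definition shift_tuple v : n.-tuple {mpoly A[n]} :=
  [tuple 'X_l + (v l)%:MP | l < n].

Definition shift v p := p \mPo shift_tuple v.

HB.instance Definition _ v := GRing.RMorphism.copy (shift v) (comp_mpoly (shift_tuple v)).

Lemma shiftX v l : shift v 'X_l = 'X_l + (v l)%:MP.
Proof. by rewrite /shift comp_mpolyXU -tnth_nth tnth_mktuple. Qed.

Lemma shiftC v c : shift v c%:MP = c%:MP.
Proof. exact: comp_mpolyC. Qed.

Lemma shiftZ v c p : shift v (c *: p) = c *: shift v p.
Proof. exact: comp_mpolyZ. Qed.

Lemma shift_shift v w p : shift w (shift v p) = shift (fun l => v l + w l) p.
Proof.
apply: (@eq_mpoly_rmorph _ _ _ (shift w \o shift v)) => [c|l] /=.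
  by rewrite !shiftC.
rewrite !shiftX rmorphD /= shiftX shiftC mpolyCD -addrA; congr (_ + _).
exact: addrC.
Qed.

Lemma shift0 v p : v =1 (fun=> 0) -> shift v p = p.
Proof.
move=> v0; apply: (@eq_mpoly_rmorph _ _ _ (shift v) idfun) => [c|l] /=.
  by rewrite shiftC.
by rewrite shiftX v0 mpolyC0 addr0.
Qed.

Lemma shift_ext v w p : v =1 w -> shift v p = shift w p.
Proof.
move=> vw; apply: (@eq_mpoly_rmorph _ _ _ (shift v) (shift w)) => [c|l] /=.
  by rewrite !shiftC.
by rewrite !shiftX vw.
Qed.

Lemma shiftK v p : shift (fun l => - v l) (shift v p) = p.
Proof. by rewrite shift_shift shift0 // => l; rewrite subrr. Qed.

Lemma shiftKV v p : shift v (shift (fun l => - v l) p) = p.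
Proof. by rewrite shift_shift shift0 // => l; rewrite addNr. Qed.

Definition scale (a : A) p := p \mPo scale_tuple n a.

HB.instance Definition _ a := GRing.RMorphism.copy (scale a) (comp_mpoly (scale_tuple n a)).

Lemma scaleX a l : scale a 'X_l = a *: 'X_l.
Proof. by rewrite /scale comp_mpolyXU -tnth_nth tnth_mktuple. Qed.

Lemma scaleC a c : scale a c%:MP = c%:MP.
Proof. exact: comp_mpolyC. Qed.

Lemma scaleZ a c p : scale a (c *: p) = c *: scale a p.
Proof. exact: comp_mpolyZ. Qed.

Lemma scaleXm a m : scale a 'X_[m] = a ^+ mdeg m *: 'X_[m].
Proof.
rewrite mpolyXE_id rmorph_prod mdegE expr_sum -scaler_prod.
by apply: eq_bigr => l _; rewrite rmorphXn /= scaleX exprZn.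
Qed.

Lemma mcoeff_scale a p m : (scale a p)@_m = a ^+ mdeg m * p@_m.
Proof.
elim/mpolyind: p => [|c m' p _ _ IHp]; first by rewrite rmorph0 mcoeff0 mulr0.
rewrite rmorphD /= !mcoeffD IHp mulrDr scaleZ scaleXm !mcoeffZ mcoeffX.
by congr (_ + _); have [->|] := eqVneq; rewrite ?mulr0 // !mulr1 mulrC.
Qed.

Lemma scale_scale a b p : scale a (scale b p) = scale (a * b) p.
Proof. by apply/mpolyP => m; rewrite !mcoeff_scale exprMn mulrA. Qed.

Lemma scale1 p : scale 1 p = p.
Proof. by apply/mpolyP => m; rewrite mcoeff_scale expr1n mul1r. Qed.

Lemma meval_scale a p v : (scale a p).@[v] = p.@[fun l => a * v l].
Proof.
rewrite /scale comp_mpoly_meval; apply: meval_eq => l.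
by rewrite tnth_mktuple mevalZ mevalXU.
Qed.

Lemma mem_Gm_act a (J : ideal {mpoly A[n]}) p :
  (p \in Gm_act a J) = (scale a p \in J).
Proof. exact: (@mem_ideal_preim _ _ (comp_mpoly (scale_tuple n a))). Qed.

Lemma shift_scale a v p :
  shift v (scale a p) = scale a (shift (fun l => a * v l) p).
Proof.
apply: (@eq_mpoly_rmorph _ _ _ (shift v \o scale a)
   (scale a \o shift (fun l => a * v l))) => [c|l] /=.
  by rewrite !(shiftC, scaleC).
rewrite scaleX shiftZ !shiftX rmorphD /= scaleX scaleC scalerDr.
by rewrite -[a *: (v l)%:MP]mul_mpolyC -mpolyCM.
Qed.

Lemma meval_homog_scale d a p v :
  p \is d.-homog -> p.@[fun l => a * v l] = a ^+ d * p.@[v].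
Proof.
move=> p_hom; rewrite -meval_scale -mevalZ; congr (_.@[v]).
apply/mpolyP => m; rewrite mcoeff_scale mcoeffZ.
have [->//|dm] := eqVneq (mdeg m) d.
by rewrite (dhomog_nemf_coeff p_hom dm) !mulr0.
Qed.

End Shift.

Lemma map_shift n (A B : comNzRingType) (g : {rmorphism A -> B})
    (v : 'I_n -> A) (w : 'I_n -> B) p : (forall l, w l = g (v l)) ->
  map_mpoly g (shift v p) = shift w (map_mpoly g p).
Proof.
move=> wE; apply: (@eq_mpoly_rmorph _ _ _ (map_mpoly g \o shift v)
  (shift w \o map_mpoly g)) => [c|l] /=.
  by rewrite shiftC !map_mpolyC shiftC.
by rewrite shiftX rmorphD /= map_mpolyX map_mpolyC shiftX wE.
Qed.

Definition strM n (A : comNzRingType) (J : ideal {mpoly A[n]}) :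
  {rmorphism A -> quot J} := proj J \o @mpolyC n A.

Lemma proj_comb n (A : comNzRingType) (J : ideal {mpoly A[n]}) d
    (c : 'I_d -> A) (e : 'I_d -> {mpoly A[n]}) :
  \sum_x str J (c x) * proj J (e x) = proj J (\sum_x c x *: e x).
Proof.
rewrite raddf_sum; apply: eq_bigr => x _.
by rewrite /= -mul_mpolyC rmorphM.
Qed.

Lemma meval_at0 n (A : comNzRingType) (p : {mpoly A[n]}) :
  p.@[fun=> 0] = p@_0%MM.
Proof.
elim/mpolyind: p => [|c m p _ _ IHp]; first by rewrite rmorph0 mcoeff0.
rewrite rmorphD /= IHp mcoeffD mevalZ mcoeffZ mcoeffX; congr (_ * _ + _).
rewrite mevalX -mdeg_eq0 mdegE; have [m0|] := eqVneq.
  rewrite big1 // => l _; move/eqP: m0.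
  by rewrite sum_nat_eq0 => /forall_inP/(_ l isT)/eqP ->.
rewrite sum_nat_eq0 => /forall_inPn[l _ ml].
by rewrite (bigD1 l) //= expr0n (negPf ml) mul0r.
Qed.

Section Geometry.
Variables (k : fieldType) (n : nat) (F : {mpoly k[n]}).
Hypothesis char0 : [pchar k] =i pred0.
Hypothesis cubicF : F \is 3.-homog.
Hypothesis freeF : derivs_free F.
Implicit Types A B : comNzRingType.

Lemma perp_annih : perp F =i annih F idfun.
Proof.
by move=> p; apply/idP/idP => [/(perp_contractP F char0)|/annihP] p0;
  [apply/annihP | apply/(perp_contractP F char0)].
Qed.

Lemma map_comb (b : 'I_n -> {mpoly k[n]}) s A B (i : {rmorphism k -> A})
    (j : {rmorphism k -> B}) (g : {rmorphism A -> B}) c0 c1 c2 c3 :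
  (forall c, j c = g (i c)) ->
  map_mpoly g (comb b s i c0 c1 c2 c3) =
  comb b s j (g c0) (fun l => g (c1 l)) (fun l => g (c2 l)) (g c3).
Proof.
move=> jE; rewrite /comb !rmorphD /=; congr (_ + _ + _ + _).
- exact: map_mpolyC.
- by rewrite rmorph_sum; apply: eq_bigr => l _; rewrite /= map_mpolyZ map_mpolyX.
- rewrite rmorph_sum; apply: eq_bigr => l _; rewrite /= map_mpolyZ.
  by rewrite (map_mpoly_compE _ jE).
by rewrite map_mpolyZ (map_mpoly_compE _ jE).
Qed.

Lemma reduce_map (b : 'I_n -> {mpoly k[n]}) s A (i : {rmorphism k -> A}) p :
  map_mpoly i (reduce F b s idfun p) = reduce F b s i (map_mpoly i p).
Proof.
have cE q : contract F i (map_mpoly i q) = i (contract F idfun q).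
  exact: contract_map.
have iE c : i c = i (idfun c) by [].
rewrite /reduce (map_comb _ _ _ _ _ _ iE); apply: eq_comb => [|l|l|].
- by rewrite map_mpoly_id -cE rmorphM.
- by rewrite map_mpoly_id -cE rmorphM.
- by rewrite -cE rmorphM /= map_mpolyX.
by rewrite cE.
Qed.

(** An element of [annih] is an [A]-combination of the differences between a
    monomial and its reduction, and these are defined over [k]. *)
Lemma base_change_perp A (i : {rmorphism k -> A}) :
  base_change i (perp F) =i annih F i.
Proof.
move=> p; apply/idP/idP => [|p0].
  by apply: base_change_min => f; apply: annih_map.
have [b [s bsP]] := exists_dual_bases char0 cubicF freeF.
pose red A (i : {rmorphism k -> A}) := reduce F b s i.
have red_sum : red A i p = \sum_(m <- msupp p) p@_m *: red A i 'X_[m].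
  have red0 : red A i 0 = 0 by rewrite /red reduce0 ?ideal0.
  have redD q q' : red A i (q + q') = red A i q + red A i q'.
    by have := reduce_lin F b s i 1 q q'; rewrite !scale1r.
  have redZ c q : red A i (c *: q) = c *: red A i q.
    by have := reduce_lin F b s i c q 0; rewrite !addr0 [reduce _ _ _ _ 0]red0 addr0.
  rewrite {1}[p]mpolyE (big_morph (red A i) redD red0).
  by apply: eq_bigr => m _; rewrite redZ.
rewrite -[p]subr0 -(reduce0 b s p0) -/(red A i) red_sum {1}[p]mpolyE -sumrB.
apply: ideal_sum_in => m _; rewrite -scalerBr mpolyZ_in //.
rewrite -(map_mpolyX i) /red -reduce_map -rmorphB mem_base_change //.
by rewrite perp_annih; apply: reduceP.
Qed.

(** * Points of the scheme of [perp F] *)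

Definition zero_of A (i : {rmorphism k -> A}) (r : 'I_n -> A) : Prop :=
  forall f, f \in perp F -> (map_mpoly i f).@[r] = 0.

Lemma annih_meval A (i : {rmorphism k -> A}) r p :
  zero_of i r -> p \in annih F i -> p.@[r] = 0.
Proof.
move=> r0; rewrite -base_change_perp.
pose V := [pred q : {mpoly A[n]} | q.@[r] == 0].
have V0 : 0 \in V by rewrite inE rmorph0.
have Vl a : {in V &, forall u v, a * u + v \in V}.
  by move=> u v; rewrite !inE rmorphD rmorphM /= => /eqP -> /eqP ->; rewrite mulr0 addr0.
move=> pF; apply/eqP; move: p pF.
by apply: (@base_change_min _ _ _ i (perp F) (Ideal V0 Vl)) => f /r0/eqP.
Qed.

Lemma zero_of_map A B (i : {rmorphism k -> A}) (j : {rmorphism k -> B})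
    (g : {rmorphism A -> B}) r r' :
  (forall c, j c = g (i c)) -> (forall l, r' l = g (r l)) ->
  zero_of i r -> zero_of j r'.
Proof.
move=> jE rE r0 f fF; rewrite -(map_mpoly_compE _ jE).
by rewrite (meval_map_mpoly _ rE) r0 ?rmorph0.
Qed.

(** The pairing is graded, hence so is its kernel. *)
Lemma perp_pihomog d f : f \in perp F -> pihomog mdeg d f \in perp F.
Proof.
rewrite !perp_annih => /annihP f0; apply: annihXP => m.
have Xm : 'X_[k, m] \is (mdeg m).-homog by rewrite dhomogX.
have [dm|dm] := eqVneq (d + mdeg m)%N 3%N; last first.
  by apply: contract_dhomog (dhomogM (pihomogP mdeg d f) Xm) dm.
rewrite -[RHS](f0 'X_[m]); apply/eqP; rewrite -subr_eq0 -contractB -mulrBl; apply/eqP.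
apply: (contract_no3 cubicF) => m' m'3.
apply/memN_msupp_eq0/negP => /msuppM_le /allpairsP[[m1 m2] /= []].
rewrite mcoeff_msupp mcoeffB mcoeff_pihomog msuppX inE => m1f /eqP -> m'E.
move: m1f; have -> : mdeg m1 == d.
  by rewrite -(eqn_add2r (mdeg m)) dm -m'3 m'E mdegD.
by rewrite subrr eqxx.
Qed.

Lemma zero_of_scale A (i : {rmorphism k -> A}) c r :
  zero_of i r -> zero_of i (fun l => c * r l).
Proof.
move=> r0 f fF.
have fE := pihomog_partitionE (mf := mdeg) (leqnn (msize f)).
rewrite fE [map_mpoly i _]rmorph_sum rmorph_sum big1 // => d _ /=.
rewrite (meval_homog_scale c r (d := d)); last first.
  by apply: dhomog_map; apply: pihomogP.
by rewrite r0 ?mulr0 // perp_pihomog.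
Qed.

Section Gen.
Variables (b : 'I_n -> {mpoly k[n]}) (s : {mpoly k[n]}).
Hypothesis bsP : dual_bases F b s.

(** The element of the Gorenstein algebra that represents, for its pairing,
    the functional of evaluation at [r]; it generates the residual ideal. *)
Definition residual_gen A (i : {rmorphism k -> A}) r : {mpoly A[n]} :=
  comb b s i (map_mpoly i s).@[r] (fun l => (map_mpoly i (b l)).@[r]) r 1.

Lemma contract_gen A (i : {rmorphism k -> A}) r g : zero_of i r ->
  contract F i (residual_gen i r * g) = g.@[r].
Proof.
move=> r0; have /annihP gred := reduceP cubicF bsP i g.
have /annih_meval : zero_of i r by [].
move=> /(_ _ (reduceP cubicF bsP i g)); rewrite rmorphB => /eqP.
rewrite subr_eq0 => /eqP ->; transitivity (contract F i (residual_gen i r * reduce F b s i g)).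
  by apply/eqP; rewrite -subr_eq0 -contractB -mulrBr mulrC gred.
rewrite mulrC {1}/reduce contract_combM [in RHS]/reduce /comb !rmorphD /=.
have genX l : contract F i ('X_l * residual_gen i r) = r l.
  by rewrite mulrC contract_combX.
have genb l : contract F i (map_mpoly i (b l) * residual_gen i r)
    = (map_mpoly i (b l)).@[r].
  by rewrite mulrC contract_combb.
rewrite mevalC mevalZ [map_mpoly i s * _]mulrC contract_combs //.
rewrite contract_comb // mulr1; congr (_ + _ + _ + _).
- by rewrite rmorph_sum; apply: eq_bigr => l _; rewrite /= mevalZ mevalXU genX.
- by rewrite rmorph_sum; apply: eq_bigr => l _; rewrite /= mevalZ genb.
Qed.

Lemma gen_residual A (i : {rmorphism k -> A}) r : zero_of i r ->
  residual_gen i r \in residual F i r.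
Proof.
move=> r0; apply/residualP => g; rewrite contract_gen //.
by rewrite contract_comb // mul1r.
Qed.

Lemma residual_decomp A (i : {rmorphism k -> A}) r p : zero_of i r ->
  p \in residual F i r -> p - contract F i p *: residual_gen i r \in annih F i.
Proof.
move=> r0 /residualP pE; apply/annihP => g.
by rewrite mulrBl contractB pE -scalerAl contractZ contract_gen // subrr.
Qed.

Lemma map_gen A B (i : {rmorphism k -> A}) (j : {rmorphism k -> B})
    (g : {rmorphism A -> B}) r r' :
  (forall c, j c = g (i c)) -> (forall l, r' l = g (r l)) ->
  map_mpoly g (residual_gen i r) = residual_gen j r'.
Proof.
move=> jE rE; rewrite /residual_gen (map_comb _ _ _ _ _ _ jE).
apply: eq_comb => [|l|l|]; rewrite ?rmorph1 //;
  by rewrite -(map_mpoly_compE _ jE) (meval_map_mpoly _ rE).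
Qed.

End Gen.

(** The pairing commutes with base change, whence one inclusion; the other one
    holds because [residual] is generated by [perp F] and [residual_gen], both
    of which are compatible with base change. *)
Lemma base_change_residual A B (i : {rmorphism k -> A}) (j : {rmorphism k -> B})
    (g : {rmorphism A -> B}) r r' :
  (forall c, j c = g (i c)) -> (forall l, r' l = g (r l)) -> zero_of i r ->
  base_change g (residual F i r) =i residual F j r'.
Proof.
move=> jE rE r0 q; have [b [s bsP]] := exists_dual_bases char0 cubicF freeF.
apply/idP/idP.
  apply: base_change_min => p /residualP pE; apply: residualXP => m.
  rewrite -(map_mpolyX g) -rmorphM !(contract_map F _ jE) (meval_map_mpoly _ rE).
  by rewrite pE rmorphM.
move=> qr; have r0' := zero_of_map jE rE r0.
rewrite -[q](subrK (contract F j q *: residual_gen b s j r')) idealD //.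
  move: (residual_decomp bsP r0' qr); rewrite -base_change_perp.
  apply: base_change_min => f fF; rewrite -(map_mpoly_compE _ jE).
  by apply/mem_base_change/annih_residual/annih_map.
rewrite mpolyZ_in // -(map_gen _ _ jE rE) mem_base_change //.
exact: gen_residual.
Qed.

Section Spike.
Variables (A : comNzRingType) (i : {rmorphism k -> A}).

(** The ideal of the translate by [v] of the scheme residual to [r]. *)
Definition spike r v : ideal {mpoly A[n]} := ideal_preim (shift v) (residual F i r).

Lemma spikeE r v p : (p \in spike r v) = (shift v p \in residual F i r).
Proof. by []. Qed.

Lemma eq_residual r r' : r =1 r' -> residual F i r =i residual F i r'.
Proof.
move=> rE p; apply/residualP/residualP => pE g; rewrite pE;
  by congr (_ * _); apply: meval_eq => l.
Qed.

End Spike.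

Lemma base_change_spike A B (i : {rmorphism k -> A}) (j : {rmorphism k -> B})
    (g : {rmorphism A -> B}) r r' v v' :
  (forall c, j c = g (i c)) -> (forall l, r' l = g (r l)) ->
  (forall l, v' l = g (v l)) -> zero_of i r ->
  base_change g (spike i r v) =i spike j r' v'.
Proof.
move=> jE rE vE r0 q; have resE := base_change_residual jE rE r0.
apply/idP/idP.
  apply: base_change_min => p; rewrite !spikeE -(map_shift _ vE) -resE.
  exact: mem_base_change.
rewrite spikeE -resE -{2}[q](shiftK v').
move: (shift v' q) => {q} y yres.
suff : y \in ideal_preim (shift (fun l => - v' l)) (base_change g (spike i r v)).
  by rewrite mem_ideal_preim.
apply: (base_change_min _ yres) => p pres.
change (shift (fun l => - v' l) (map_mpoly g p) \in base_change g (spike i r v)).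
have nvE l : - v' l = g (- v l) by rewrite vE rmorphN.
by rewrite -(map_shift _ nvE) mem_base_change // spikeE shiftKV.
Qed.

(** [contract] is homogeneous of degree 3, so that scaling by a unit multiplies
    both sides of the equations of [residual] by the same unit. *)
Lemma Gm_act_spike A (i : {rmorphism k -> A}) a a' r v r' v' : a * a' = 1 ->
  (forall l, r' l = a * r l) -> (forall l, v' l = a * v l) ->
  spike i r' v' =i Gm_act a (spike i r v).
Proof.
move=> aa rE vE p; rewrite (spikeE i r' v' p) mem_Gm_act.
rewrite (spikeE i r v (scale a p)) shift_scale -(shift_ext _ vE).
move: (shift v' p) => {p} q.
have contract_scale g : contract F i (scale a g) = a ^+ 3 * contract F i g.
  rewrite -contractZ; apply/eqP; rewrite -subr_eq0 -contractB; apply/eqP.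
  apply: (contract_no3 cubicF) => m m3.
  by rewrite mcoeffB mcoeff_scale mcoeffZ m3 subrr.
have meval_r g : (scale a g).@[r] = g.@[r'].
  by rewrite meval_scale; apply: meval_eq => l; rewrite rE.
apply/residualP/residualP => qE g.
  rewrite -[g]scale1 -aa -scale_scale -rmorphM !contract_scale qE meval_r.
  by rewrite mulrA.
have a3 : a' ^+ 3 * a ^+ 3 = 1 by rewrite -exprMn [a' * a]mulrC aa expr1n.
rewrite -[LHS]mul1r -a3 -mulrA -contract_scale rmorphM qE meval_r contract_scale.
by rewrite -[X in _ * X]mulrA [LHS]mulrA a3 mul1r.
Qed.

(** At the origin [residual_gen] is the socle generator [s], which together with
    [perp F] generates the ideal of the fixed point. *)
Lemma base_change_top_degree A (i : {rmorphism k -> A}) :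
  base_change i (ideal_sum (perp F) (Sge k n 3)) =i residual F i (fun=> 0).
Proof.
have [b [s bsP]] := exists_dual_bases char0 cubicF freeF.
have [_ _ s_hom s1] := bsP; have b_hom l : b l \is 2.-homog by case: bsP.
have z0 : zero_of i (fun=> 0).
  move=> f fF; rewrite meval_at0 mcoeff_map_mpoly -[RHS](rmorph0 i); congr (i _).
  have := perp_pihomog 0 fF; rewrite perp_annih => /annihP/(_ s).
  have -> : pihomog mdeg 0 f = (f@_0%MM)%:MP.
    apply/mpolyP => m; rewrite mcoeff_pihomog mcoeffC mdeg_eq0 eq_sym.
    by case: eqP => [->|_]; rewrite ?mulr1 ?mulr0.
  by rewrite mul_mpolyC contractZ s1 mulr1.
move=> p; apply/idP/idP.
  apply: base_change_min => q qI.
  suff : q \in ideal_preim (map_mpoly i) (residual F i (fun=> 0)) by rewrite mem_ideal_preim.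
  apply: ideal_span_min qI => _ [y [z [yF z3 ->]]].
  apply: idealD; rewrite mem_ideal_preim /=; first exact/annih_residual/annih_map.
  apply: residualXP => m; rewrite meval_at0 mcoeffX.
  have [->|m0] := eqVneq m 0%MM; first by rewrite mpolyX0 !mulr1.
  rewrite mulr0; apply: (contract_no3 cubicF) => m' m'3.
  apply/memN_msupp_eq0/negP => /msuppM_le /allpairsP[[m1 m2] /= []].
  rewrite mcoeff_msupp mcoeff_map_mpoly msuppX inE => m1z /eqP -> m'E.
  have /(allP z3) : m1 \in msupp z.
    by rewrite mcoeff_msupp; apply: contraNneq m1z => ->; rewrite raddf0.
  rewrite -m'3 m'E mdegD -[X in (_ <= X)%N -> _]addn0 leq_add2l leqn0 mdeg_eq0.
  by rewrite (negPf m0).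
move=> pr; rewrite -[p](subrK (contract F i p *: residual_gen b s i (fun=> 0))).
have sumF f : f \in perp F -> f \in ideal_sum (perp F) (Sge k n 3).
  by move=> fF; apply: mem_ideal_span; exists f, 0; rewrite ideal0 addr0.
apply: idealD; last apply: mpolyZ_in.
  have := residual_decomp bsP z0 pr; rewrite -base_change_perp.
  by apply: base_change_min => f /sumF fI; apply: mem_base_change.
have -> : residual_gen b s i (fun=> 0) = map_mpoly i s.
  rewrite /residual_gen (@eq_comb _ _ _ _ _ _ _ _ _ _ 0 (fun=> 0) (fun=> 0) 1) //.
  - by rewrite /comb mpolyC0 !big1 ?add0r ?scale1r // => l _; rewrite scale0r.
  - by rewrite meval_at0 (dhomog_nemf_coeff (dhomog_map i s_hom)) //= mdeg0.
  by move=> l; rewrite meval_at0 (dhomog_nemf_coeff (dhomog_map i (b_hom l))) //= mdeg0.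
apply/mem_base_change/mem_ideal_span; exists 0, s; rewrite ideal0 add0r; split => //.
by apply/allP => m /(dhomogP _ _ _ s_hom)/= ->.
Qed.

End Geometry.

(** * Algebras with a finite basis *)

Section FiniteBasis.
Variables (A : comNzRingType) (Q : comPzRingType) (phi : {rmorphism A -> Q}).
Variables (d : nat) (e : 'I_d -> Q).
Hypothesis eP : is_basis phi e.

Lemma basis_coord : exists co : Q -> 'I_d -> A,
  forall x, x = \sum_l phi (co x l) * e l.
Proof. by have [/choice[co coP] _] := eP; exists co. Qed.

Lemma basis_inj (c c' : 'I_d -> A) :
  \sum_l phi (c l) * e l = \sum_l phi (c' l) * e l -> c =1 c'.
Proof.
move=> /eqP; rewrite -subr_eq0 -sumrB => /eqP cc' l; apply/eqP.
rewrite -subr_eq0; apply/eqP; have [_ free_e] := eP.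
apply: (free_e (fun l => c l - c' l)); rewrite -[RHS]cc'.
by apply: eq_bigr => l' _; rewrite rmorphB mulrBl.
Qed.

Lemma basis_finite : finite_alg phi.
Proof. by exists d, e; case: eP. Qed.

(** A tensor is zero as soon as all its coordinates are, and the coordinates
    are computed by bilinear maps into the module itself. *)
Lemma basis_flat : flat_alg phi.
Proof.
have [co coP] := basis_coord.
have coD l x y : co (x + y) l = co x l + co y l.
  apply: (basis_inj (c' := fun l => co x l + co y l)); rewrite -coP.
  rewrite {1}[x]coP {1}[y]coP -big_split; apply: eq_bigr => l' _ /=.
  by rewrite rmorphD mulrDl.
have coZ l a x : co (phi a * x) l = a * co x l.
  apply: (basis_inj (c' := fun l => a * co x l)); rewrite -coP.
  rewrite {1}[x]coP mulr_sumr; apply: eq_bigr => l' _.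
  by rewrite rmorphM mulrA.
move=> N N' u u_inj s s0 P b [bDl bDr bZl bZr].
have b0l y : b 0 y = 0 by apply: (@addrI _ (b 0 y)); rewrite -bDl !addr0.
have b0r x : b x 0 = 0 by apply: (@addrI _ (b x 0)); rewrite -bDr !addr0.
have coord0 l : \sum_(z <- s) co z.1 l *: z.2 = 0.
  apply: u_inj; rewrite raddf0 raddf_sum /=.
  have bil : bilinear_alg phi (fun x (y : N') => co x l *: y).
    split=> [x y m|x m m'|a x m|a x m] /=; first by rewrite coD scalerDl.
    - by rewrite scalerDr.
    - by rewrite coZ scalerA.
    by rewrite !scalerA mulrC.
  rewrite -[RHS](s0 _ _ bil) big_map; apply: eq_bigr => z _.
  by rewrite /= linearZ.
transitivity (\sum_(z <- s) \sum_l b (e l) (co z.1 l *: z.2)).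
  apply: eq_bigr => z _; rewrite {1}[z.1]coP.
  rewrite (big_morph (b^~ z.2) (fun x y => bDl x y z.2) (b0l z.2)).
  by apply: eq_bigr => l _; rewrite bZl bZr.
rewrite exchange_big big1 // => l _ /=.
by rewrite -(big_morph (b (e l)) (bDr (e l)) (b0r (e l))) coord0 b0r.
Qed.

Lemma trace_basis_indep (e' : 'I_d -> Q) (z : Q) (M M' : 'M[A]_d) :
  is_basis phi e' ->
  (forall x, z * e x = \sum_y phi (M x y) * e y) ->
  (forall x, z * e' x = \sum_y phi (M' x y) * e' y) ->
  \tr M = \tr M'.
Proof.
move=> e'P ME M'E; have [gen_e _] := eP; have [gen_e' _] := e'P.
have [p pE] := choice (fun x => gen_e (e' x)).
have [p' p'E] := choice (fun x => gen_e' (e x)).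
pose P : 'M[A]_d := \matrix_(x, y) p x y.
pose P' : 'M[A]_d := \matrix_(x, y) p' x y.
have mul_sum (f g : 'I_d -> 'I_d -> A) (w : 'I_d -> Q) x :
    \sum_y phi (f x y) * (\sum_u phi (g y u) * w u)
      = \sum_u phi (\sum_y f x y * g y u) * w u.
  under eq_bigr do rewrite mulr_sumr.
  rewrite exchange_big; apply: eq_bigr => u _ /=.
  by rewrite rmorph_sum mulr_suml; apply: eq_bigr => y _; rewrite rmorphM mulrA.
have P'P : P' *m P = 1%:M.
  apply/matrixP => x u; rewrite !mxE.
  under eq_bigr do rewrite !mxE.
  apply: (basis_inj (c := fun u => \sum_y p' x y * p y u)
                    (c' := fun u => (x == u)%:R)).
  rewrite -mul_sum; under eq_bigr do rewrite -pE.
  rewrite -p'E (bigD1 x) //= eqxx rmorph1 mul1r big1 ?addr0 // => y.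
  by rewrite eq_sym => /negPf ->; rewrite rmorph0 mul0r.
have M'P : M' *m P = P *m M.
  apply/matrixP => x u; rewrite !mxE.
  under eq_bigr do rewrite mxE; under [RHS]eq_bigr do rewrite mxE.
  apply: (basis_inj (c := fun u => \sum_y M' x y * p y u)
                    (c' := fun u => \sum_y p x y * M y u)).
  rewrite -!mul_sum; under eq_bigr do rewrite -pE.
  rewrite -M'E pE mulr_sumr; apply: eq_bigr => y _.
  by rewrite mulrCA ME.
rewrite -[M]mul1mx -P'P -mulmxA -M'P mxtrace_mulC -mulmxA.
by rewrite (mulmx1C P'P) mulmx1.
Qed.

End FiniteBasis.


Section SpikeBasis.
Variables (k : fieldType) (n : nat) (F : {mpoly k[n]}).
Hypothesis char0 : [pchar k] =i pred0.
Hypothesis cubicF : F \is 3.-homog.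
Hypothesis freeF : derivs_free F.
Variables (A : comNzRingType) (i : {rmorphism k -> A}) (r v : 'I_n -> A).
Hypothesis r0 : zero_of F i r.
Variables (b : 'I_n -> {mpoly k[n]}) (s : {mpoly k[n]}).
Hypothesis bsP : dual_bases F b s.

Definition index3 (T : Type) (c0 : T) (c1 c2 : 'I_n -> T) (x : 'I_(1 + (n + n))) : T :=
  match split x with
  | inl _ => c0
  | inr y => match split y with inl l => c1 l | inr l => c2 l end
  end.

Lemma sum_index3 (V : nmodType) (f : 'I_(1 + (n + n)) -> V) :
  \sum_x f x = f (lshift _ ord0) + (\sum_l f (rshift 1 (lshift n l))
    + \sum_l f (rshift 1 (rshift n l))).
Proof. by rewrite big_split_ord big_ord1 big_split_ord. Qed.

Lemma index30 T c0 c1 c2 : @index3 T c0 c1 c2 (lshift _ ord0) = c0.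
Proof.
by rewrite /index3; case: split_ordP => // j /eqP; rewrite eq_shift.
Qed.

Lemma index31 T c0 c1 c2 l : @index3 T c0 c1 c2 (rshift 1 (lshift n l)) = c1 l.
Proof.
rewrite /index3; case: split_ordP => j /eqP; rewrite eq_shift //= => /eqP <-.
by case: split_ordP => j' /eqP; rewrite eq_shift // => /eqP <-.
Qed.

Lemma index32 T c0 c1 c2 l : @index3 T c0 c1 c2 (rshift 1 (rshift n l)) = c2 l.
Proof.
rewrite /index3; case: split_ordP => j /eqP; rewrite eq_shift //= => /eqP <-.
by case: split_ordP => j' /eqP; rewrite eq_shift // => /eqP <-.
Qed.

Let bA l := map_mpoly i (b l).

Definition residual_basis : 'I_(1 + (n + n)) -> {mpoly A[n]} :=
  index3 1 (fun l => 'X_l) bA.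

(** The coordinates after the socle element has been eliminated by means of
    [residual_gen]. *)
Definition residual_coord (p : {mpoly A[n]}) : 'I_(1 + (n + n)) -> A :=
  let c := contract F i p in
  index3 (contract F i (p * map_mpoly i s) - c * (map_mpoly i s).@[r])
    (fun l => contract F i (p * bA l) - c * (bA l).@[r])
    (fun l => contract F i (p * 'X_l) - c * r l).

Lemma sum_residual_basis (c : 'I_(1 + (n + n)) -> A) :
  \sum_x c x *: residual_basis x = comb b s i (c (lshift _ ord0))
    (fun l => c (rshift 1 (lshift n l))) (fun l => c (rshift 1 (rshift n l))) 0.
Proof.
rewrite sum_index3 /residual_basis /comb scale0r addr0 -addrA index30.
rewrite -mul_mpolyC mulr1; congr (_ + (_ + _)).
  by apply: eq_bigr => l _; rewrite index31.
by apply: eq_bigr => l _; rewrite index32.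
Qed.

Lemma residual_coordP p :
  p - \sum_x residual_coord p x *: residual_basis x \in residual F i r.
Proof.
have -> : \sum_x residual_coord p x *: residual_basis x =
    - contract F i p *: residual_gen b s i r + reduce F b s i p.
  rewrite sum_residual_basis comb_lin; apply: eq_comb => [|l|l|];
    rewrite /residual_coord ?(index30, index31, index32) ?mulr1 ?mulNr;
    by rewrite ?addNr // addrC.
rewrite opprD scaleNr opprK addrCA addrC; apply: idealD.
  by apply/annih_residual; apply: reduceP.
by apply: mpolyZ_in; apply: gen_residual.
Qed.

Lemma residual_basis_free c :
  \sum_x c x *: residual_basis x \in residual F i r -> c =1 (fun=> 0).
Proof.
rewrite sum_residual_basis => /residualP; rewrite contract_comb // => c0 x.
have combM0 g := etrans (c0 g) (mul0r _).
case: (split_ordP x) => [y ->|y ->].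
  by rewrite ord1 -(combM0 (map_mpoly i s)) contract_combs.
case: (split_ordP y) => l ->.
  by rewrite -(combM0 (map_mpoly i (b l))) contract_combb.
by rewrite -(combM0 'X_l) contract_combX.
Qed.

Variable U : ideal {mpoly A[n]}.
Hypothesis UE : U =i spike F i r v.

Definition spike_basis (x : 'I_(1 + (n + n))) : quot U :=
  proj U (shift (fun l => - v l) (residual_basis x)).

Lemma spike_memE p : (p \in U) = (shift v p \in residual F i r).
Proof. by rewrite UE. Qed.

Lemma spike_basis_sum c :
  \sum_x str U (c x) * spike_basis x
    = proj U (shift (fun l => - v l) (\sum_x c x *: residual_basis x)).
Proof.
rewrite proj_comb; congr (proj U _); rewrite rmorph_sum; apply: eq_bigr => x _.
by rewrite /= shiftZ.
Qed.

Lemma spike_coordP p :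
  proj U p = \sum_x str U (residual_coord (shift v p) x) * spike_basis x.
Proof.
rewrite spike_basis_sum; apply/eqP.
by rewrite projE spike_memE rmorphB /= shiftKV residual_coordP.
Qed.

Lemma spike_basisP : is_basis (str U) spike_basis.
Proof.
split=> [x|c].
  exists (residual_coord (shift v (lift_quot x))).
  by rewrite -[LHS]lift_quotK; apply: spike_coordP.
rewrite spike_basis_sum => /eqP; rewrite mem_proj0 spike_memE shiftKV.
exact: residual_basis_free.
Qed.

(** On the quotient by [perp F] the variables are nilpotent, of trace zero; the
    residual quotient lacks the line on which they act by the scalars [r j]. *)
Lemma spike_trace j (M : 'M[A]_(1 + (n + n))) :
  (forall x, proj U 'X_j * spike_basis x = \sum_y str U (M x y) * spike_basis y) ->
  \tr M = (1 + (n + n))%:R * v j - r j.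
Proof.
move=> ME; have := spike_basisP.
pose N : 'M[A]_(1 + (n + n)) := \matrix_(x, y)
  residual_coord (('X_j + (v j)%:MP) * residual_basis x) y.
have NE x : proj U 'X_j * spike_basis x = \sum_y str U (N x y) * spike_basis y.
  rewrite -rmorphM [LHS]spike_coordP; apply: eq_bigr => y _.
  by rewrite rmorphM /= shiftKV shiftX mxE.
move=> eP; rewrite (trace_basis_indep (phi := strM U) eP eP ME NE).
have X1 l : 'X_l \is [in A[n], 1.-homog] by rewrite dhomogX /= mdeg1.
have b2 l : bA l \is 2.-homog by apply: dhomog_map; case: bsP.
have s3 : map_mpoly i s \is 3.-homog by apply: dhomog_map; case: bsP.
have c0 d p : p \is d.-homog -> d != 3%N -> contract F i p = 0.
  exact: contract_dhomog.
have coord_lin a p q x :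
    residual_coord (a *: p + q) x = a * residual_coord p x + residual_coord q x.
  rewrite /residual_coord.
  have lin (f : {mpoly A[n]} -> A) (c t : A) :
      (f (a *: p + q) = a * f p + f q) ->
      f (a *: p + q) - contract F i (a *: p + q) * t
      = a * (f p - contract F i p * t) + (f q - contract F i q * t).
    by move=> ->; rewrite contractD contractZ mulrBr mulrDl opprD addrACA -mulrA.
  have lint t : contract F i ((a *: p + q) * t)
      = a * contract F i (p * t) + contract F i (q * t).
    by rewrite mulrDl contractD -scalerAl contractZ.
  case: (split_ordP x) => [y ->|y ->].
    by rewrite ord1 !index30 (lin (fun u => contract F i (u * map_mpoly i s))).
  case: (split_ordP y) => l ->.
    by rewrite !index31 (lin (fun u => contract F i (u * bA l))).
  by rewrite !index32 (lin (fun u => contract F i (u * 'X_l))).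
have coord_basis x : residual_coord (residual_basis x) x = 1.
  have := residual_coordP (residual_basis x).
  have -> : residual_basis x = \sum_y (y == x)%:R *: residual_basis y.
    rewrite (bigD1 x) //= eqxx scale1r big1 ?addr0 // => y /negPf ->.
    by rewrite scale0r.
  set p := \sum_y _; rewrite -sumrB.
  under eq_bigr do rewrite -scalerBl.
  move=> /residual_basis_free/(_ x)/eqP; rewrite subr_eq0 eqxx.
  by move=> /eqP <-.
rewrite /mxtrace; under eq_bigr => x _.
  rewrite mxE mulrDl mul_mpolyC addrC coord_lin coord_basis mulr1.
over.
rewrite big_split /= sumr_const card_ord -[v j *+ _]mulr_natl; congr (_ + _).
rewrite sum_index3 /residual_coord /residual_basis.
rewrite !index30 mulr1 (c0 _ _ (X1 j)) // mul0r (c0 _ _ (dhomogM (X1 j) s3)) //.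
rewrite subr0 add0r big1 ?add0r => [|l _]; last first.
  rewrite !index31 (c0 _ _ (dhomogM (X1 j) (X1 l))) // mul0r subr0.
  by rewrite (c0 _ _ (dhomogM (dhomogM (X1 j) (X1 l)) (b2 l))).
have [_ bX _ _] := bsP.
rewrite (eq_bigr (fun l => - (r l * (l == j)%:R))) => [|l _].
  by rewrite sumrN sum_delta.
rewrite !index32 (c0 _ _ (dhomogM (dhomogM (X1 j) (b2 l)) (X1 l))) // sub0r.
rewrite -(map_mpolyX i) -rmorphM (contract_map F (i := idfun)) // bX rmorph_nat.
by rewrite mulrC eq_sym.
Qed.

End SpikeBasis.

(** * Torsion in flat quotients *)

Section QuotModule.
Variables (n : nat) (R : comNzRingType) (J : ideal {mpoly R[n]}).

Definition quot_mod := quot J.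

HB.instance Definition _ := GRing.Zmodule.on quot_mod.

Definition quot_scale (a : R) (x : quot_mod) : quot_mod := strM J a * (x : quot J).

Fact quot_scaleA a b x : quot_scale a (quot_scale b x) = quot_scale (a * b) x.
Proof. by rewrite /quot_scale rmorphM mulrA. Qed.

Fact quot_scale1 : left_id 1 quot_scale.
Proof. by move=> x; rewrite /quot_scale rmorph1 mul1r. Qed.

Fact quot_scaleDr : right_distributive quot_scale +%R.
Proof. by move=> a x y; rewrite /quot_scale mulrDr. Qed.

Fact quot_scaleDl x : {morph quot_scale^~ x : a b / a + b}.
Proof. by move=> a b; rewrite /quot_scale rmorphD mulrDl. Qed.

HB.instance Definition _ := GRing.Zmodule_isLmodule.Build R quot_mod
  quot_scaleA quot_scale1 quot_scaleDr quot_scaleDl.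

(** Tensoring the injection [c * _ : R -> R] with the quotient shows that a
    non zero divisor of [R] stays one modulo [J]. *)
Lemma flat_torsion_free (c : R) p :
  flat_alg (str J) -> injective ( *%R c) -> c *: p \in J -> p \in J.
Proof.
move=> flatJ c_inj cpJ.
have c_lin : linear (fun x : R^o => c * x : R^o).
  by move=> a x y; rewrite mulrDr; congr (_ + _); apply: mulrCA.
pose u : {linear R^o -> R^o} := HB.pack (fun x : R^o => c * x : R^o)
  (GRing.isLinear.Build R R^o R^o _ (fun x : R^o => c * x : R^o) c_lin).
have tensor0 : tensor_eq0 (str J) [:: (proj J p, 1 : R^o)].
  apply: (flatJ _ _ u c_inj) => P b [bDl bDr bZl bZr].
  have b0 y : b 0 y = 0 by apply: (@addrI _ (b 0 y)); rewrite -bDl !addr0.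
  rewrite /= big_seq1 /= bZr -bZl -rmorphM /= mul_mpolyC.
  by move: cpJ; rewrite -mem_proj0 => /eqP ->.
have bil : bilinear_alg (str J) (fun x (a : R^o) => strM J a * x : quot_mod).
  split=> [x y a|x a a'|a x a'|a x a']; first by rewrite mulrDr.
  - by rewrite rmorphD mulrDl.
  - exact: mulrCA.
  by rewrite rmorphM -mulrA.
have := tensor0 quot_mod _ bil; rewrite big_seq1 /= => p0.
by rewrite -mem_proj0 -[proj J p]mul1r -(rmorph1 (strM J)); apply/eqP.
Qed.

End QuotModule.
(** * Homogeneous families over the line *)

(** Differences of distinct elements of [k] are units, so [P] can be divided by
    the [X - c] one after the other, as in Newton interpolation. *)
Lemma ideal_vandermonde (k : fieldType) (R : comNzRingType) (g : {rmorphism k -> R})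
    (J : ideal R) (s : seq k) (P : {poly R}) :
  uniq s -> (size P <= size s)%N -> {in s, forall c, P.[g c] \in J} ->
  forall d, P`_d \in J.
Proof.
elim: s P => [|x s IHs] P /=.
  by rewrite leqn0 size_poly_eq0 => _ /eqP -> _ d; rewrite coef0 ideal0.
case/andP=> xs uniq_s szP PJ d.
have Px : P.[g x] \in J by apply: PJ; rewrite inE eqxx.
have /factor_theorem[Q PE] : root (P - P.[g x]%:P) (g x).
  by rewrite /root hornerD hornerN hornerC subrr.
have QJ : forall e, Q`_e \in J.
  apply: IHs => // [|y ys].
    have [->|Q0] := eqVneq Q 0; first by rewrite size_poly0.
    have : (size (Q * ('X - (g x)%:P))%R <= (size s).+1)%N.
      rewrite -PE (leq_trans (size_polyD _ _)) // size_polyN geq_max szP.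
      by rewrite (leq_trans (size_polyC_leq1 _)).
    by rewrite size_Mmonic ?monicXsubC // size_XsubC addn2.
  have xy : y - x != 0 by rewrite subr_eq0; apply: contraNneq xs => <-.
  have -> : Q.[g y] = g (y - x)^-1 * (P.[g y] - P.[g x]).
    have := congr1 (fun q => q.[g y]) PE.
    rewrite hornerM hornerXsubC !hornerE => ->.
    by rewrite mulrCA -rmorphB -rmorphM mulVf // rmorph1 mulr1.
  by rewrite idealM // idealB // PJ // inE ys orbT.
rewrite -[P](subrK P.[g x]%:P) PE coefD mulrBr coefB coefMX coefMC coefC.
apply: idealD; last by case: ifP => // _; apply: ideal0.
apply: idealB; first by case: ifP => // _; apply: ideal0.
by rewrite mulrC idealM.
Qed.

Lemma mcoeff_sum_supp n (R S : comNzRingType) (p : {mpoly R[n]})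
    (f : 'X_{1..n} -> S) m :
  (m \notin msupp p -> f m = 0) ->
  (\sum_(m <- msupp p) f m *: 'X_[m])@_m = f m.
Proof.
move=> f0; rewrite raddf_sum /=; have [mp|mp] := boolP (m \in msupp p).
  rewrite (bigD1_seq m) ?msupp_uniq //= mcoeffZ mcoeffX eqxx mulr1 big1 ?addr0 //.
  by move=> m' /negPf nm; rewrite mcoeffZ mcoeffX nm mulr0.
rewrite f0 // big_seq big1 // => m' m'p; rewrite mcoeffZ mcoeffX.
by case: eqP => [mE|_]; [rewrite -mE m'p in mp | rewrite mulr0].
Qed.

Section Homogenize.
Variables (n : nat) (A : comNzRingType).
Implicit Types (p : {mpoly {poly A}[n]}) (P : {mpoly A[n]}).

(** The homogenization of [P] if its degree is at most [d]; above [d] the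
    truncated exponent is 0 and the formula has no meaning. *)
Definition homogenize d P : {mpoly {poly A}[n]} :=
  \sum_(m <- msupp P) (P@_m *: 'X^(d - mdeg m)) *: 'X_[m].

(** The component of degree [d] of [p] for the grading in which the variable of
    the base line also has degree 1, with this variable set to 1. *)
Definition hpart d p : {mpoly A[n]} :=
  \sum_(m <- msupp p)
    (if (mdeg m <= d)%N then (p@_m)`_(d - mdeg m) else 0) *: 'X_[m].

Definition at_one : {rmorphism {poly A} -> A} := horner_eval (1 : A).

Lemma mcoeff_homogenize d P m : (homogenize d P)@_m = P@_m *: 'X^(d - mdeg m).
Proof.
by apply: mcoeff_sum_supp => /memN_msupp_eq0 ->; rewrite scale0r.
Qed.

Lemma mcoeff_hpart d p m :
  (hpart d p)@_m = if (mdeg m <= d)%N then (p@_m)`_(d - mdeg m) else 0.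
Proof.
by apply: mcoeff_sum_supp => /memN_msupp_eq0 ->; rewrite coef0 if_same.
Qed.

Lemma msize_hpart d p : (msize (hpart d p) <= d.+1)%N.
Proof. by apply/msize_leP => m; rewrite mcoeff_hpart ltnNge => /negPf ->. Qed.

Lemma homogenizeD d P Q : homogenize d (P + Q) = homogenize d P + homogenize d Q.
Proof.
by apply/mpolyP => m; rewrite mcoeffD !mcoeff_homogenize mcoeffD scalerDl.
Qed.

Lemma homogenize0 d : homogenize d 0 = 0.
Proof. by apply/mpolyP => m; rewrite mcoeff_homogenize !mcoeff0 scale0r. Qed.

Lemma homogenize_shift d e P : (msize P <= d.+1)%N ->
  homogenize (d + e) P = 'X^e *: homogenize d P.
Proof.
move=> /msize_leP P0; apply/mpolyP => m; rewrite mcoeffZ !mcoeff_homogenize.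
have [md|/P0 ->] := leqP (mdeg m) d; last by rewrite !scale0r mulr0.
by rewrite -scalerAr -exprD addnC addnBA.
Qed.

Lemma homogenize_at_one d P : map_mpoly at_one (homogenize d P) = P.
Proof.
apply/mpolyP => m; rewrite mcoeff_map_mpoly mcoeff_homogenize /=.
by rewrite /horner_eval hornerZ hornerXn expr1n mulr1.
Qed.

Lemma homogenize_at_zero d P : (msize P <= d.+1)%N ->
  map_mpoly (at_zero A) (homogenize d P) = pihomog mdeg d P.
Proof.
move=> /msize_leP P0; apply/mpolyP => m; rewrite mcoeff_map_mpoly mcoeff_homogenize.
rewrite mcoeff_pihomog /= /horner_eval hornerZ hornerXn expr0n subn_eq0.
rewrite eqn_leq; have [md|/P0 ->] := leqP (mdeg m) d; last by rewrite mul0r.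
by rewrite /=; case: (d <= mdeg m)%N; rewrite ?mulr1 ?mulr0.
Qed.

Lemma hpart_at_zero d p m : mdeg m = d ->
  (hpart d p)@_m = (map_mpoly (at_zero A) p)@_m.
Proof.
move=> md; rewrite mcoeff_hpart mcoeff_map_mpoly md leqnn subnn /=.
by rewrite /horner_eval horner_coef0.
Qed.

Definition rescale (c : A) : {rmorphism {poly A} -> {poly A}} :=
  comp_poly (c *: 'X).

Lemma coef_rescale c (q : {poly A}) j : (rescale c q)`_j = c ^+ j * q`_j.
Proof.
rewrite /= /rescale comp_polyE coef_sum.
have E e : (q`_e *: (c *: 'X) ^+ e)`_j = (j == e)%:R * (c ^+ e * q`_e).
  by rewrite exprZn scalerA coefZ coefXn mulrC [q`_e * _]mulrC.
rewrite (eq_bigr (fun e : 'I__ => (j == e)%:R * (c ^+ e * q`_e))) => [|e _].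
  have [jq|jq] := ltnP j (size q).
    rewrite (bigD1 (Ordinal jq)) //= eqxx mul1r big1 ?addr0 // => e.
    by rewrite eq_sym -val_eqE => /negPf /= ->; rewrite mul0r.
  rewrite nth_default // mulr0 big1 // => e _.
  by rewrite gtn_eqF ?mul0r // (leq_trans (ltn_ord e)).
exact: E.
Qed.

Definition total_degree_lt D p : Prop :=
  forall m j, (D <= mdeg m + j)%N -> (p@_m)`_j = 0.

Lemma exists_total_degree p d : exists2 D, total_degree_lt D p & (d < D)%N.
Proof.
exists (msize p + \max_(m <- msupp p) size p@_m + d.+1)%N; last first.
  by rewrite addnS ltnS leq_addl.
move=> m j Dmj; have [mp|/memN_msupp_eq0 ->] := boolP (m \in msupp p); last first.
  by rewrite coef0.
apply: nth_default; have := msize_mdeg_lt mp.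
have szM : (size p@_m <= \max_(m <- msupp p) size p@_m)%N.
  exact: (@leq_bigmax_seq _ _ xpredT (fun m => size p@_m)).
move: (\max_(m <- _) _)%N szM Dmj => M szM Dmj dm.
rewrite leqNgt; apply/negP => szj; move: Dmj; rewrite leqNgt => /negP; apply.
apply: leq_trans (leq_addr d.+1 _); rewrite -addSn leq_add //.
by apply: leq_trans szM; apply: ltnW.
Qed.

Lemma sum_hpart c D p : total_degree_lt D p ->
  \sum_(d < D) ((c ^+ d)%:P *: homogenize d (hpart d p))
    = scale (c%:P) (map_mpoly (rescale c) p).
Proof.
move=> pD; apply/mpolyP => m; apply/polyP => j.
rewrite mcoeff_scale mcoeff_map_mpoly -rmorphXn coefCM coef_rescale mulrA -exprD.
rewrite raddf_sum coef_sum.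
have E (d : nat) : (((c ^+ d)%:P *: homogenize d (hpart d p))@_m)`_j =
    (d == mdeg m + j)%N%:R * (c ^+ d * (p@_m)`_j).
  rewrite mcoeffZ coefCM mcoeff_homogenize coefZ coefXn mcoeff_hpart.
  have [md|md] := leqP (mdeg m) d.
    have -> : (d == mdeg m + j)%N = (j == d - mdeg m)%N.
      by rewrite -{1}(subnKC md) eqn_add2l eq_sym.
    by case: eqP => [->|_]; rewrite ?mul1r ?mul0r ?mulr1 ?mulr0.
  by rewrite mul0r mulr0 ltn_eqF ?mul0r // (leq_trans md) ?leq_addr.
rewrite (eq_bigr (fun d : 'I_D => (d == mdeg m + j :> nat)%:R * (c ^+ d * (p@_m)`_j)))
  => [|d _]; last exact: E.
have [Dmj|mjD] := leqP D (mdeg m + j).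
  by rewrite pD // mulr0 big1 // => d _; rewrite !mulr0.
rewrite (bigD1 (Ordinal mjD)) //= eqxx mul1r big1 ?addr0 // => d.
by rewrite -val_eqE => /negPf /= ->; rewrite mul0r.
Qed.

Lemma hpart_sum D p : total_degree_lt D p ->
  p = \sum_(d < D) homogenize d (hpart d p).
Proof.
move=> pD; transitivity (scale (1 : A)%:P (map_mpoly (rescale 1) p)).
  rewrite scale1; apply/mpolyP => m; apply/polyP => j.
  by rewrite mcoeff_map_mpoly coef_rescale expr1n mul1r.
rewrite -(sum_hpart 1 pD); apply: eq_bigr => d _.
by rewrite expr1n scale1r.
Qed.

End Homogenize.

Section GradedFamilies.
Variables (k : fieldType) (n : nat) (A : comNzRingType) (i : {rmorphism k -> A}).
Hypothesis char0 : [pchar k] =i pred0.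
Implicit Types (p : {mpoly {poly A}[n]}) (P : {mpoly A[n]}).

Lemma equivariant_rescale (J : ideal {mpoly {poly A}[n]}) (c : k) p :
  Gm_equivariant J -> c != 0 -> p \in J ->
  scale (i c)%:P (map_mpoly (rescale (i c)) p) \in J.
Proof.
move=> eqJ c0 pJ.
have cc' : (i c)%:P * (i c^-1)%:P = 1 :> {poly A}.
  by rewrite -polyCM -rmorphM mulfV // rmorph1.
have hC a : rescale (i c) a%:P = idfun a%:P by rewrite /= /rescale comp_polyC.
have hX : rescale (i c) 'X = (i c)%:P * idfun 'X.
  by rewrite /= /rescale comp_polyX mul_polyC.
have E := eqJ _ _ _ (idfun : {rmorphism {poly A} -> {poly A}}) (rescale (i c))
  cc' hC hX (map_mpoly (rescale (i c)) p).
have pE := etrans (esym E) (mem_base_change (rescale (i c)) pJ).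
have := etrans (esym (mem_Gm_act _ _ _)) pE.
by rewrite base_change_id.
Qed.

(** The scalings by the infinitely many elements of [k^*] separate the
    homogeneous components. *)
Lemma equivariant_hpart (J : ideal {mpoly {poly A}[n]}) d p :
  Gm_equivariant J -> p \in J -> homogenize d (hpart d p) \in J.
Proof.
move=> eqJ pJ; have [D pD dD] := exists_total_degree p d.
pose g : {rmorphism k -> {mpoly {poly A}[n]}} := @mpolyC n {poly A} \o polyC \o i.
pose Q := \poly_(e < D) homogenize e (hpart e p).
have -> : homogenize d (hpart d p) = Q`_d by rewrite coef_poly dD.
pose s := [seq e.+1%:R : k | e <- iota 0 D].
have s_uniq : uniq s.
  rewrite map_inj_uniq ?iota_uniq // => e e' ee'.
  wlog le_ee' : e e' ee' / (e <= e')%N => [IH|].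
    by case/orP: (leq_total e e') => [/IH->|/IH<-].
  apply/eqP; rewrite eqn_leq le_ee' -subn_eq0.
  move/pcharf0P: char0 => /(_ (e' - e)%N) <-.
  by rewrite -subSS natrB ?ltnS // ee' subrr eqxx.
apply: (ideal_vandermonde (g := g) s_uniq).
  by rewrite size_map size_iota size_poly.
move=> _ /mapP[e _ ->]; rewrite horner_poly.
have := equivariant_rescale eqJ (nat_neq0 char0 e) pJ.
rewrite -(sum_hpart _ pD); congr (_ \in J); apply: eq_bigr => f _.
by rewrite -mul_mpolyC mulrC -rmorphXn /= !rmorphXn.
Qed.

Variable J : ideal {mpoly {poly A}[n]}.
Hypothesis eqJ : Gm_equivariant J.
Hypothesis tfJ : forall e p, 'X^e *: p \in J -> p \in J.

Let U := base_change (at_one A) J.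

Lemma mem_at_one P : P \in U -> exists2 p, p \in J & P = map_mpoly (at_one A) p.
Proof.
by apply: (@base_change_onto _ _ _ _ polyC) => c; rewrite /= /horner_eval hornerC.
Qed.

(** Multiplying by a power of the base variable brings the components of an
    element of [J] with value [P] at 1 to the same degree; the power can then
    be removed because [J] has no torsion. *)
Lemma homogenize_in d P : P \in U -> (msize P <= d.+1)%N -> homogenize d P \in J.
Proof.
move=> /mem_at_one[p pJ PE] Pd; have [D pD _] := exists_total_degree p 0.
apply: (@tfJ D); rewrite -homogenize_shift //.
have -> : P = \sum_(e < D) hpart e p.
  rewrite PE {1}(hpart_sum pD) rmorph_sum; apply: eq_bigr => e _.
  exact: homogenize_at_one.
rewrite (big_morph _ (@homogenizeD n A (d + D)) (@homogenize0 n A _)).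
apply: ideal_sum_in => e _.
have -> : (d + D = e + (d + (D - e)))%N by rewrite addnCA subnKC // ltnW.
rewrite homogenize_shift ?msize_hpart // mpolyZ_in //.
exact: equivariant_hpart.
Qed.

Lemma top_degree_in d P : P \in U -> (msize P <= d.+1)%N ->
  pihomog mdeg d P \in base_change (at_zero A) J.
Proof.
move=> PU Pd; rewrite -homogenize_at_zero //.
by apply/mem_base_change/homogenize_in.
Qed.

Lemma top_degree_lift d f : f \in base_change (at_zero A) J -> f \is d.-homog ->
  exists P, [/\ P \in U, (msize P <= d.+1)%N & pihomog mdeg d P = f].
Proof.
have zeroK : cancel polyC (at_zero A).
  by move=> c; rewrite /= /horner_eval hornerC.
move=> /(base_change_onto zeroK)[p pJ fE] f_hom.
exists (hpart d p); split; last 1 first.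
- apply/mpolyP => m; rewrite mcoeff_pihomog.
  have [md|md] := eqVneq (mdeg m) d; first by rewrite hpart_at_zero // -fE.
  by rewrite (dhomog_nemf_coeff f_hom md).
- rewrite -(homogenize_at_one d (hpart d p)).
  by apply/mem_base_change/equivariant_hpart.
exact: msize_hpart.
Qed.

End GradedFamilies.

(** A graded torsion free family over the line is the homogenization of its
    fibre over 1. *)
Lemma equivariant_determined (k : fieldType) n (A : comNzRingType)
    (i : {rmorphism k -> A}) (char0 : [pchar k] =i pred0)
    (J J' : ideal {mpoly {poly A}[n]}) :
  Gm_equivariant J -> Gm_equivariant J' ->
  (forall e p, 'X^e *: p \in J' -> p \in J') ->
  {subset base_change (at_one A) J <= base_change (at_one A) J'} ->
  {subset J <= J'}.
Proof.
move=> eqJ eqJ' tfJ' JJ' p pJ; have [D pD _] := exists_total_degree p 0.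
rewrite (hpart_sum pD); apply: ideal_sum_in => d _.
apply: (homogenize_in i char0 eqJ' tfJ'); last exact: msize_hpart.
apply: JJ'; rewrite -(homogenize_at_one d (hpart d p)).
by apply/mem_base_change/(equivariant_hpart i char0).
Qed.

(** * Tangent vectors of negative degree *)

(** Solutions over [A] of a linear system with coefficients in the field [k]
    are [A]-combinations of solutions over [k]: the matrix [P] projects onto
    the kernel of the system. *)
Lemma linear_system_descent (k : fieldType) (A : comNzRingType)
    (i : {rmorphism k -> A}) (I J : finType) (M : I -> J -> k) (x : I -> A) :
  (forall j, \sum_a x a * i (M a j) = 0) ->
  exists P : I -> I -> k, (forall a0 j, \sum_a P a0 a * M a j = 0) /\
    forall a, x a = \sum_a0 x a0 * i (P a0 a).
Proof.
move=> xM0.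
pose N : 'M[k]_(#|I|, #|J|) := \matrix_(u, v) M (enum_val u) (enum_val v).
pose Q := 1%:M - N *m pinvmx N.
have QN : Q *m N = 0 by rewrite mulmxBl mul1mx mulmxKpV ?submx_refl // subrr.
exists (fun a0 a => Q (enum_rank a0) (enum_rank a)); split=> [a0 j|a].
  move/matrixP/(_ (enum_rank a0) (enum_rank j)): QN; rewrite !mxE => QN0.
  rewrite -[RHS]QN0 (reindex (@enum_val I I)) /=; last first.
    by apply: onW_bij; apply: enum_val_bij.
  by apply: eq_bigr => u _; rewrite enum_valK [N _ _]mxE enum_rankK.
have QE u v : Q u v = (u == v)%:R - (N *m pinvmx N) u v.
  by rewrite [LHS]mxE [X in X + _]mxE [X in _ + X]mxE.
under eq_bigr do rewrite QE rmorphB mulrBr.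
rewrite sumrB (bigD1 a) //= eqxx rmorph1 mulr1 big1 ?addr0 => [|a0 a0a]; last first.
  by rewrite (inj_eq enum_rank_inj) (negPf a0a) rmorph0 mulr0.
rewrite (eq_bigr (fun a0 => \sum_w x a0 * i (M a0 (enum_val w)) *
    i (pinvmx N w (enum_rank a)))) => [|a0 _].
  rewrite exchange_big big1 ?subr0 // => w _ /=.
  by rewrite -mulr_suml xM0 mul0r.
rewrite mxE rmorph_sum mulr_sumr; apply: eq_bigr => w _.
by rewrite rmorphM mulrA mxE enum_rankK.
Qed.

Lemma msize_mulS n (A : comNzRingType) (p q : {mpoly A[n]}) d e :
  (msize p <= d)%N -> (msize q <= e.+1)%N -> (msize (p * q)%R <= d + e)%N.
Proof.
move=> /msize_leP p0 /msize_leP q0; apply/msize_leP => m dm.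
apply/memN_msupp_eq0/negP => /msuppM_le /allpairsP[[m1 m2] /= [m1p m2q mE]].
have m1d : (mdeg m1 < d)%N.
  by rewrite ltnNge; apply: contraTN m1p => /p0 pm; rewrite mcoeff_msupp pm eqxx.
have m2e : (mdeg m2 <= e)%N.
  by rewrite leqNgt; apply: contraTN m2q => /q0 qm; rewrite mcoeff_msupp qm eqxx.
by move: dm; rewrite mE mdegD leqNgt -addSn leq_add.
Qed.

Lemma pihomogM_homog n (A : comNzRingType) (p q : {mpoly A[n]}) d e :
  q \is e.-homog -> pihomog mdeg (d + e) (p * q) = pihomog mdeg d p * q.
Proof.
move=> q_hom; elim/mpolyind: p => [|c m p _ _ IHp]; first by rewrite mul0r !raddf0 mul0r.
rewrite mulrDl !raddfD /= IHp mulrDl; congr (_ + _).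
rewrite -scalerAl !linearZ /= pihomogX -scalerAl; congr (_ *: _).
have mq : 'X_[m] * q \is (mdeg m + e).-homog.
  by apply: dhomogM => //; rewrite dhomogX.
case: eqP => [<-|/eqP dm]; first by rewrite pihomog_dE.
by rewrite mul0r (pihomog_ne0 _ mq) // eqn_add2r.
Qed.

Lemma pihomogM_low n (A : comNzRingType) (p q : {mpoly A[n]}) d e :
  q \is e.-homog -> (d < e)%N -> pihomog mdeg d (p * q) = 0.
Proof.
move=> q_hom de; apply/mpolyP => m; rewrite mcoeff_pihomog mcoeff0.
case: eqP => // md; apply/memN_msupp_eq0/negP => /msuppM_le.
move=> /allpairsP[[m1 m2] /= [_ m2q mE]]; move: de.
by rewrite -md mE mdegD (dhomogP _ _ _ q_hom m2 m2q) /= ltnNge leq_addl.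
Qed.

Section Low.
Variables (k : fieldType) (n : nat) (F : {mpoly k[n]}).
Hypothesis char0 : [pchar k] =i pred0.
Hypothesis cubicF : F \is 3.-homog.
Hypothesis freeF : derivs_free F.

(** In degrees 0 and 1 the pairing is perfect. *)
Lemma annih_low (A : comNzRingType) (i : {rmorphism k -> A}) p :
  p \in annih F i -> (msize p <= 2)%N -> p = 0.
Proof.
have [b [s bsP]] := exists_dual_bases char0 cubicF freeF.
move=> /annihP p0 /msize_leP p2.
have pE : p = comb b s i p@_0%MM (fun l => p@_U_(l)%MM) (fun=> 0) 0.
  rewrite /comb scale0r addr0 [X in _ + X]big1 ?addr0 => [|l _]; last exact: scale0r.
  apply/mpolyP => m; rewrite mcoeffD mcoeffC raddf_sum /=.
  under eq_bigr do rewrite mcoeffZ mcoeffX.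
  case dm: (mdeg m) => [|[|d]].
  - have -> : m = 0%MM by apply/eqP; rewrite -mdeg_eq0 dm.
    rewrite eqxx mulr1 big1 ?addr0 // => l _.
    by rewrite -mdeg_eq0 mdeg1 mulr0.
  - have /mdeg1P[j /eqP ->] : mdeg m == 1%N by rewrite dm.
    rewrite mnm1_eq0 mulr0 add0r (bigD1 j) //= eqxx mulr1.
    rewrite big1 ?addr0 // => l lj; case: eqP => [|_]; last by rewrite mulr0.
    by move/mnmP/(_ l); rewrite !mnm1E eqxx eq_sym (negPf lj).
  rewrite p2 ?dm // big1 ?addr0 => [|l _].
    by rewrite -mdeg_eq0 dm mulr0.
  by case: eqP => [mE|_]; rewrite ?mulr0 // -mE mdeg1 in dm *.
have -> : p = 0%:MP + \sum_l 0 *: 'X_l.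
  rewrite pE /comb scale0r addr0 [X in _ + X = _]big1 ?addr0 => [|l _]; last exact: scale0r.
  congr (_%:MP + _).
    by have := p0 (map_mpoly i s); rewrite {1}pE contract_combs.
  apply: eq_bigr => l _; congr (_ *: _).
  by have := p0 (map_mpoly i (b l)); rewrite {1}pE contract_combb.
by rewrite mpolyC0 add0r big1 // => l _; rewrite scale0r.
Qed.

(** Orthogonality to the two dual bases is a finite linear system over [k]. *)
Lemma annih_descent (A : comNzRingType) (i : {rmorphism k -> A}) (I J : finType)
    (f : I -> J -> {mpoly k[n]}) (x : I -> A) :
  (forall j, \sum_a x a *: map_mpoly i (f a j) \in annih F i) ->
  exists P : I -> I -> k,
    (forall a0 j, \sum_a P a0 a *: f a j \in perp F) /\
    forall a, x a = \sum_a0 x a0 * i (P a0 a).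
Proof.
have [b [s bsP]] := exists_dual_bases char0 cubicF freeF.
pose test (u : bool + ('I_n + 'I_n)) : {mpoly k[n]} :=
  match u with
  | inl true => 1 | inl false => s | inr (inl l) => 'X_l | inr (inr l) => b l
  end.
have testP (B : comNzRingType) (j : {rmorphism k -> B}) (p : {mpoly B[n]}) :
    (forall u, contract F j (p * map_mpoly j (test u)) = 0) -> p \in annih F j.
  move=> p0; apply: (annih_pairP cubicF bsP) => [|l|l|].
  - by have := p0 (inl true); rewrite rmorph1 mulr1.
  - by have := p0 (inr (inl l)); rewrite /= map_mpolyX.
  - exact: (p0 (inr (inr l))).
  exact: (p0 (inl false)).
move=> x0; pose M a (ju : J * (bool + ('I_n + 'I_n))) : k :=
  contract F idfun (f a ju.1 * test ju.2).
have [[j u]|P [P0 xE]] := @linear_system_descent k A i I _ M x.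
  have /annihP/(_ (map_mpoly i (test u))) := x0 j.
  rewrite mulr_suml contract_sum => xj0; rewrite -[RHS]xj0; apply: eq_bigr => a _.
  by rewrite -scalerAl contractZ -rmorphM (contract_map F (i := idfun)).
exists P; split=> // a0 j; rewrite perp_annih //; apply: testP => u.
rewrite map_mpoly_id mulr_suml contract_sum -[RHS](P0 a0 (j, u)).
by apply: eq_bigr => a _; rewrite -scalerAl contractZ.
Qed.

Lemma perp_no1 : 1 \notin perp F.
Proof.
rewrite perp_annih //; apply/negP => /annih_low; rewrite msize1 => /(_ isT)/eqP.
by rewrite oner_eq0.
Qed.

(** The fourth power of alpha_j lies in [perp F]; applying the field four times to
    it gives the constant 24 (w_j)^4, which lies in [perp F] only if w_j = 0. *)
Lemma field_preserving_perp (w : 'I_n -> k) :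
  (forall f, f \in perp F -> \sum_l w l *: f^`M(l) \in perp F) -> forall j, w j = 0.
Proof.
move=> DF j; apply/eqP/negPn/negP => wj.
have powE m : \sum_l w l *: ('X_[k, U_(j) *+ m.+1])^`M(l)
    = (w j * m.+1%:R) *: 'X_[U_(j) *+ m].
  rewrite (bigD1 j) //= big1 ?addr0 => [|l lj].
    rewrite mderivX scalerA mulmnE mnm1E eqxx mul1n; congr (_ *: 'X_[_]).
    by apply/mnmP => l; rewrite mnmBE !mulmnE mulnS addKn.
  by rewrite mderivX mulmnE mnm1E eq_sym (negPf lj) mul0n scale0r scaler0.
have down m : 'X_[U_(j) *+ m.+1] \in perp F -> 'X_[U_(j) *+ m] \in perp F.
  move=> /DF; rewrite powE => /(mpolyZ_in (w j * m.+1%:R)^-1).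
  by rewrite scalerA mulVf ?scale1r // mulf_neq0 // nat_neq0.
have : 'X_[U_(j) *+ 4] \in perp F.
  rewrite perp_annih //; apply: annih_deg4 => // m.
  by rewrite msuppX inE => /eqP ->; rewrite mdegMn mdeg1.
move=> /down/down/down/down; rewrite mulm0n mpolyX0.
by apply/negP; apply: perp_no1.
Qed.

End Low.

Section NegativeTangents.
Variables (k : fieldType) (n : nat) (F : {mpoly k[n]}).
Hypothesis char0 : [pchar k] =i pred0.
Hypothesis cubicF : F \is 3.-homog.
Hypothesis freeF : derivs_free F.
Local Notation S := {mpoly k[n]}.
Local Notation K := (perp F).

Definition deriv_hom (l : 'I_n) : S -> quot K := fun f => proj K f^`M(l).

Lemma deriv_hom_neg l : hom_neg (deriv_hom l).
Proof.
exists 1%N, (fun=> deriv_hom l); split=> [j|f _]; last by rewrite big_ord1.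
rewrite ord1; split=> [a f g fK gK|d f fK f_hom].
  rewrite /deriv_hom mderivD mderivM !rmorphD /= !rmorphM /=.
  have -> : proj K f = 0 by apply/eqP; rewrite mem_proj0.
  by rewrite mulr0 add0r.
exists (f^`M(l)) => //; apply/allP => m; rewrite mcoeff_msupp mcoeff_mderiv => mf.
have /(dhomogP _ _ _ f_hom)/= : (m + U_(l))%MM \in msupp f.
  by rewrite mcoeff_msupp; apply: contraNneq mf => ->; rewrite mul0rn.
by rewrite mdegD mdeg1 => <-; rewrite PoszD addrK.
Qed.

Lemma deriv_hom_free (c : 'I_n -> k) :
  {in K, forall f, \sum_l str K (c l) * deriv_hom l f = 0} -> forall l, c l = 0.
Proof.
move=> c0; apply: (field_preserving_perp char0 cubicF freeF) => f /c0.
by rewrite proj_comb => /eqP; rewrite mem_proj0.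
Qed.

Hypothesis tangentF : dim_hom_neg K n.

Lemma hom_neg_deriv (u : S -> quot K) : hom_neg u ->
  exists c : 'I_n -> k, {in K, forall f, u f = \sum_l str K (c l) * deriv_hom l f}.
Proof.
have [v [_ v_free v_span]] := tangentF.
have [C CE] := choice (fun l => v_span _ (deriv_hom_neg l)).
move=> /v_span[d dE].
pose M : 'M[k]_n := \matrix_(l, j) C l j.
have combE (c : 'I_n -> k) : {in K, forall f, \sum_l str K (c l) * deriv_hom l f
    = \sum_j str K (\sum_l c l * C l j) * v j f}.
  move=> f fK; under eq_bigr => l _ do rewrite CE // mulr_sumr.
  rewrite exchange_big; apply: eq_bigr => j _ /=.
  rewrite -[str K _]/(strM K _) rmorph_sum mulr_suml; apply: eq_bigr => l _.
  by rewrite mulrA rmorphM.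
have M_unit : M \in unitmx.
  rewrite -row_free_unit; apply: inj_row_free => w wM0; apply/rowP => l.
  rewrite mxE; apply: (deriv_hom_free (c := fun l => w 0 l)) => f fK.
  rewrite combE // big1 // => j _; move/rowP/(_ j): wM0; rewrite !mxE => wM0.
  rewrite [X in str K X](_ : _ = 0) ?[str K 0](rmorph0 (strM K)) ?mul0r //.
  by rewrite -[RHS]wM0; apply: eq_bigr => l' _; rewrite mxE.
pose c : 'rV[k]_n := (\row_j d j) *m invmx M.
exists (fun l => c 0 l) => f fK; rewrite dE // combE //.
apply: eq_bigr => j _; congr (str K _ * _).
have /rowP/(_ j) : c *m M = \row_j d j by rewrite mulmxKV.
by rewrite [LHS]mxE [RHS]mxE => <-; apply: eq_bigr => l _; rewrite [M _ _]mxE.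
Qed.

Variables (b0 b1 : nat) (q : 'cV[S]_b0) (s : 'M[S]_(b1, b0)).
Hypothesis q_homog : forall t, q t 0 \is 2.-homog.
Hypothesis q_gen : forall f, f \in K <-> exists c : 'rV[S]_b0, f = (c *m q) 0 0.
Hypothesis q_syz : forall c : 'rV[S]_b0,
  c *m q = 0 <-> exists d : 'rV[S]_b1, c = d *m s.

Lemma q_perp t : q t 0 \in K.
Proof. by apply/q_gen; exists (delta_mx 0 t); rewrite -rowE mxE. Qed.

Lemma syz_rel j : \sum_t s j t * q t 0 = 0.
Proof.
have /q_syz : exists d : 'rV[S]_b1, row j s = d *m s.
  by exists (delta_mx 0 j); rewrite rowE.
move=> /matrixP/(_ 0 0); rewrite !mxE => sq0; rewrite -[RHS]sq0.
by apply: eq_bigr => t _; rewrite mxE.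
Qed.

Section FromSyzygies.
Variables (D : nat) (l : 'I_b0 -> S).
Hypothesis D2 : (D < 2)%N.
Hypothesis l_homog : forall t, l t \is D.-homog.
Hypothesis l_syz : forall j, \sum_t s j t * l t \in K.

Let val (c : 'rV[S]_b0) : S := \sum_t c 0 t * l t.

Let val_lin a c c' : val (a *: c + c') = a * val c + val c'.
Proof.
rewrite /val mulr_sumr -big_split; apply: eq_bigr => t _.
by rewrite !mxE mulrDl mulrA.
Qed.

Let val_wd c c' : (c *m q) 0 0 = (c' *m q) 0 0 -> proj K (val c) = proj K (val c').
Proof.
move=> cc'; apply/eqP; rewrite projE.
have -> : val c - val c' = val (c - c').
  by rewrite addrC -mulN1r -val_lin scaleN1r addrC.
have /q_syz[d ->] : (c - c') *m q = 0.
  by apply/matrixP => x y; rewrite !ord1 mulmxBl mxE [X in _ + X]mxE cc' subrr mxE.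
have -> : val (d *m s) = \sum_j d 0 j * \sum_t s j t * l t.
  rewrite /val; under eq_bigr do rewrite mxE mulr_suml.
  rewrite exchange_big; apply: eq_bigr => j _ /=.
  by rewrite mulr_sumr; apply: eq_bigr => t _; rewrite mulrA.
by apply: ideal_sum_in => j _; apply: idealM.
Qed.

(** Linear syzygies generate all syzygies, so values on the generators that
    respect them extend to a homomorphism; being of negative degree, it is a
    constant vector field. *)
Lemma syzygy_hom : exists c : 'I_n -> k,
  forall t, l t - \sum_j c j *: (q t 0)^`M(j) \in K.
Proof.
have [cf cfE] : {cf : S -> 'rV[S]_b0 & forall f, f \in K -> f = (cf f *m q) 0 0}.
  apply: (choice (P := fun f c => f \in K -> f = (c *m q) 0 0)) => f.
  have [/q_gen[c fE]|/negP fK] := boolP (f \in K); first by exists c.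
  by exists 0.
pose u f := proj K (val (cf f)).
have uE c f : f = (c *m q) 0 0 -> u f = proj K (val c).
  move=> fE; apply: val_wd; rewrite -fE -cfE //; apply/q_gen; by exists c.
have u_hom : is_hom u.
  move=> a f g fK gK; rewrite (uE (a *: cf f + cf g)); last first.
    by rewrite mulmxDl -scalemxAl mxE [X in _ = X + _]mxE -!cfE.
  by rewrite val_lin rmorphD rmorphM.
have u_deg : hom_deg (- (2 - D)%:Z) u.
  split=> // d f fK f_hom.
  have [d2|d2] := ltnP d 2.
    have f0 : f = 0.
      rewrite -(pihomog_dE f_hom) (cfE f fK) mxE raddf_sum big1 // => t _.
      exact: pihomogM_low (q_homog t) d2.
    exists 0; last by rewrite msupp0.
    rewrite (uE 0) ?f0 ?mul0mx ?mxE //; congr (proj K _).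
    by rewrite /val big1 // => t _; rewrite mxE mul0r.
  pose c : 'rV[S]_b0 := \row_t pihomog mdeg (d - 2) (cf f 0 t).
  exists (val c).
    apply: uE; rewrite -(pihomog_dE f_hom) {1}(cfE f fK) mxE raddf_sum mxE.
    apply: eq_bigr => t _; rewrite mxE /=.
    by rewrite -{1}(subnK d2) pihomogM_homog.
  have val_hom : val c \is (d - 2 + D).-homog.
    apply: rpred_sum => t _; apply: dhomogM => //.
    by rewrite mxE pihomogP.
  apply/allP => m /(dhomogP _ _ _ val_hom)/= ->.
  by rewrite eq_sym subr_eq -PoszD -addnA subnKC ?subnK // ltnW.
have u_neg : hom_neg u.
  exists (2 - D)%N, (fun j => if j.+1 == (2 - D)%N then u else fun=> 0).
  split=> [j|f fK].
    case: eqP => [->|_] //; split=> [a f g _ _|d f _ _].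
      by rewrite mulr0 addr0.
    by exists 0; rewrite ?rmorph0 // msupp0.
  have last_lt : (1 - D < 2 - D)%N by rewrite [(2 - D)%N]subSn.
  rewrite (bigD1 (Ordinal last_lt)) //= -subSn // eqxx big1 ?addr0 // => j.
  rewrite -val_eqE /= => nj; case: eqP => // jE.
  by move: nj; rewrite -eqSS jE -subSn // eqxx.
have [c cE] := hom_neg_deriv u_neg; exists c => t.
rewrite -projE -(proj_comb K c).
rewrite -[X in _ == X](cE _ (q_perp t)) (uE (delta_mx 0 t)); last by rewrite -rowE mxE.
rewrite /val (bigD1 t) //= mxE !eqxx mul1r big1 ?addr0 // => t' /negPf tt'.
by rewrite mxE eqxx tt' mul0r.
Qed.

End FromSyzygies.

End NegativeTangents.

(** * Translations and degree *)

Section ShiftDegree.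
Variables (n : nat) (A : comNzRingType) (w : 'I_n -> A).
Implicit Types P q : {mpoly A[n]}.

Lemma msize_shiftX m : (msize (shift w 'X_[m] - 'X_[m]) <= mdeg m)%N.
Proof.
elim: {m}(mdeg m) {-2}m (erefl (mdeg m)) => [|d IHd] m dm.
  have -> : m = 0%MM by apply/eqP; rewrite -mdeg_eq0 dm.
  by rewrite mpolyX0 rmorph1 subrr msize0.
have [l ml] : exists l, m l != 0%N.
  apply/existsP; rewrite -negb_forall; apply/negP => /forallP m0.
  by move: dm; rewrite mdegE big1 // => l _; apply/eqP/m0.
have mE : m = (U_(l) + (m - U_(l)))%MM.
  rewrite addmC submK //; apply/mnm_lepP => j; rewrite mnm1E.
  by case: eqP => // <-; rewrite lt0n.
move: (m - U_(l))%MM mE => m' mE.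
have dm' : mdeg m' = d by move: dm; rewrite mE mdegD mdeg1 => -[].
rewrite mE mpolyXD rmorphM /= shiftX.
have -> : ('X_l + (w l)%:MP) * shift w 'X_[m'] - 'X_l * 'X_[m']
    = (shift w 'X_[m'] - 'X_[m']) * ('X_l + (w l)%:MP) + (w l)%:MP * 'X_[m'].
  by ring.
rewrite mdegD mdeg1 dm' add1n (leq_trans (msizeD_le _ _)) // geq_max.
rewrite -[X in (_ <= X)%N && _]addn1 msize_mulS /=.
- rewrite mul_mpolyC (leq_trans (mmeasureZ_le _ _ _)) //.
  by rewrite mmeasureX /= dm'.
- by rewrite -dm' IHd.
rewrite (leq_trans (msizeD_le _ _)) // geq_max mmeasureX /= mdeg1.
by rewrite msizeC; case: eqP.
Qed.

Lemma msize_shiftB P d : (msize P <= d.+1)%N -> (msize (shift w P - P) <= d)%N.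
Proof.
move=> Pd; have -> : shift w P - P
    = \sum_(m <- msupp P) P@_m *: (shift w 'X_[m] - 'X_[m]).
  rewrite {1 2}[P]mpolyE rmorph_sum -sumrB; apply: eq_bigr => m _.
  by rewrite /= shiftZ scalerBr.
apply/msize_leP => m dm; rewrite raddf_sum big1_seq //= => m' m'P.
rewrite mcoeffZ; have /msize_leP -> := msize_shiftX m'; first by rewrite mulr0.
by apply: leq_trans dm; rewrite -ltnS; apply: leq_trans Pd; apply: msize_mdeg_lt.
Qed.

Lemma msize_shift P d : (msize P <= d)%N -> (msize (shift w P) <= d)%N.
Proof.
case: d => [|d] Pd.
  by move: Pd; rewrite leqn0 msize_poly_eq0 => /eqP ->; rewrite rmorph0 msize0.
rewrite -[shift w P](subrK P) (leq_trans (msizeD_le _ _)) // geq_max Pd andbT.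
exact/leqW/msize_shiftB.
Qed.

Lemma pihomog_msize P d : (msize P <= d)%N -> pihomog mdeg d P = 0.
Proof.
move=> /msize_leP P0; apply/mpolyP => m; rewrite mcoeff_pihomog mcoeff0.
by case: eqP => // md; rewrite P0 // md.
Qed.

Lemma pihomog_shift P d : (msize P <= d.+1)%N ->
  pihomog mdeg d (shift w P) = pihomog mdeg d P.
Proof.
move=> Pd; apply/eqP; rewrite -subr_eq0 -raddfB /=.
by rewrite pihomog_msize // msize_shiftB.
Qed.

Lemma shift_quadric q : q \is 2.-homog ->
  shift w q = q + \sum_l w l *: q^`M(l) + (q.@[w])%:MP.
Proof.
move=> q_hom; rewrite [q]mpolyE rmorph_sum.
have -> : \sum_l w l *: (\sum_(m <- msupp q) q@_m *: 'X_[m])^`M(l)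
    = \sum_(m <- msupp q) q@_m *: \sum_l w l *: ('X_[m])^`M(l).
  under eq_bigr do rewrite [mderiv _ _]raddf_sum scaler_sumr.
  rewrite exchange_big; apply: eq_bigr => m _; rewrite scaler_sumr.
  by apply: eq_bigr => l _; rewrite /= mderivZ !scalerA mulrC.
rewrite [meval _ _]rmorph_sum [mpolyC _ _]rmorph_sum -!big_split !big_seq; apply: eq_bigr => m mq /=.
have m2 := dhomogP _ _ _ q_hom m mq; rewrite /= in m2.
rewrite shiftZ mevalZ mpolyCM mul_mpolyC -!scalerDr; congr (_ *: _).
have [a ma] : exists a, m a != 0%N.
  apply/existsP; rewrite -negb_forall; apply/negP => /forallP m0.
  by move: m2; rewrite mdegE big1 // => l _; apply/eqP/m0.
have mE : m = (U_(a) + (m - U_(a)))%MM.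
  rewrite addmC submK //; apply/mnm_lepP => j; rewrite mnm1E.
  by case: eqP => // <-; rewrite lt0n.
move: (m - U_(a))%MM mE => m' mE.
have /mdeg1P[b /eqP m'E] : mdeg m' == 1%N.
  by move: m2; rewrite mE mdegD mdeg1 add1n => -[->].
rewrite mE m'E mpolyXD rmorphM /= !shiftX mevalM !mevalXU.
have sum_dX c : \sum_l w l *: ('X_c)^`M(l) = (w c)%:MP :> {mpoly A[n]}.
  have UU : (U_(c) - U_(c) = 0 :> 'X_{1..n})%MM by apply/mnmP => j; rewrite mnmBE subnn mnm0E.
  rewrite (bigD1 c) //= mderivX mnm1E eqxx scale1r UU mpolyX0.
  rewrite big1 ?addr0 ?alg_mpolyC // => l lc.
  by rewrite mderivX mnm1E eq_sym (negPf lc) scale0r scaler0.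
have -> : \sum_l w l *: ('X_a * 'X_b)^`M(l) = (w a)%:MP * 'X_b + 'X_a * (w b)%:MP.
  rewrite -!sum_dX mulr_suml mulr_sumr -big_split; apply: eq_bigr => l _.
  by rewrite mderivM scalerDr scalerAl scalerAr.
by rewrite mpolyCM; ring.
Qed.

End ShiftDegree.

(** * Tangent vectors over a base ring *)

Section BaseRingTangents.
Variables (k : fieldType) (n : nat) (F : {mpoly k[n]}).
Hypothesis char0 : [pchar k] =i pred0.
Hypothesis cubicF : F \is 3.-homog.
Hypothesis freeF : derivs_free F.
Hypothesis tangentF : dim_hom_neg (perp F) n.
Local Notation S := {mpoly k[n]}.
Variables (b0 b1 : nat) (q : 'cV[S]_b0) (s : 'M[S]_(b1, b0)).
Hypothesis q_homog : forall t, q t 0 \is 2.-homog.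
Hypothesis s_homog : forall j t, s j t \is 1.-homog.
Hypothesis q_gen : forall f, f \in perp F <-> exists c : 'rV[S]_b0, f = (c *m q) 0 0.
Hypothesis q_syz : forall c : 'rV[S]_b0,
  c *m q = 0 <-> exists d : 'rV[S]_b1, c = d *m s.
Variables (A : comNzRingType) (i : {rmorphism k -> A}).

(** The condition on [l] is a linear system over [k]: by [annih_descent] its
    solutions over [A] are combinations of solutions over [k], which
    [syzygy_hom] describes. *)
Lemma syzygy_hom_ring D (l : 'I_b0 -> {mpoly A[n]}) : (D < 2)%N ->
  (forall t, l t \is D.-homog) ->
  (forall j, \sum_t map_mpoly i (s j t) * l t \in annih F i) ->
  exists w : 'I_n -> A,
    forall t, l t = \sum_c w c *: map_mpoly i (q t 0)^`M(c).
Proof.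
move=> D2 l_homog l_syz.
pose T : finType := 'X_{1..n < 2}.
pose mon (m : T) : S := if mdeg m == D then 'X_[m] else 0.
have lE t : l t = \sum_(m : T) (l t)@_m *: map_mpoly i (mon m).
  have l2 : (msize (l t) <= 2)%N.
    apply/msize_leP => m m2; apply: (dhomog_nemf_coeff (l_homog t)).
    by rewrite gtn_eqF // (leq_trans D2).
  rewrite {1}(mpolywE l2); apply: eq_bigr => m _; rewrite /mon.
  case: eqP => [_|/eqP mD]; first by rewrite map_mpolyX.
  by rewrite rmorph0 (dhomog_nemf_coeff (l_homog t) mD) !scale0r.
pose x (tm : 'I_b0 * T) : A := (l tm.1)@_tm.2.
pose f (tm : 'I_b0 * T) j : S := s j tm.1 * mon tm.2.
have [j|P [P0 xE]] := @annih_descent _ _ _ char0 cubicF freeF _ i _ 'I_b1 f x.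
  suff <- : \sum_t map_mpoly i (s j t) * l t = \sum_a x a *: map_mpoly i (f a j).
    exact: l_syz.
  rewrite -(pair_bigA _ (fun t m => x (t, m) *: map_mpoly i (f (t, m) j))) /=.
  apply: eq_bigr => t _; rewrite [l t in LHS]lE mulr_sumr; apply: eq_bigr => m _.
  by rewrite rmorphM /= scalerAr.
pose l' a0 t : S := \sum_(m : T) P a0 (t, m) *: mon m.
have l'_homog a0 t : l' a0 t \is D.-homog.
  apply: rpred_sum => m _; apply: rpredZ; rewrite /mon; case: eqP => [mD|_].
    by rewrite dhomogX /= mD.
  exact: dhomog0.
have l'_syz a0 j : \sum_t s j t * l' a0 t \in perp F.
  suff -> : \sum_t s j t * l' a0 t = \sum_a P a0 a *: f a j by exact: P0.
  rewrite [RHS](eq_bigr (fun p => P a0 (p.1, p.2) *: f (p.1, p.2) j)); last by case.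
  rewrite -(pair_bigA _ (fun t m => P a0 (t, m) *: f (t, m) j)) /=.
  apply: eq_bigr => t _; rewrite mulr_sumr; apply: eq_bigr => m _.
  by rewrite scalerAr.
have [c cE] := choice (fun a0 => syzygy_hom char0 cubicF freeF tangentF
  q_homog q_gen q_syz D2 (l'_homog a0) (l'_syz a0)).
exists (fun u => \sum_a0 x a0 * i (c a0 u)) => t.
apply/eqP; rewrite -subr_eq0; apply/eqP.
have -> : l t - \sum_u (\sum_a0 x a0 * i (c a0 u)) *: map_mpoly i (q t 0)^`M(u)
    = \sum_a0 x a0 *: map_mpoly i (l' a0 t - \sum_u c a0 u *: (q t 0)^`M(u)).
  under [RHS]eq_bigr do rewrite rmorphB /= scalerBr.
  rewrite sumrB; congr (_ - _).
    rewrite lE; under [LHS]eq_bigr do rewrite -/(x (t, _)) xE scaler_suml.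
    rewrite exchange_big; apply: eq_bigr => a0 _ /=.
    rewrite [map_mpoly i (l' a0 t)]rmorph_sum scaler_sumr; apply: eq_bigr => m _.
    by rewrite /= map_mpolyZ scalerA.
  under eq_bigr do rewrite scaler_suml.
  rewrite exchange_big; apply: eq_bigr => a0 _ /=.
  rewrite [map_mpoly i _]rmorph_sum scaler_sumr; apply: eq_bigr => u _.
  by rewrite /= map_mpolyZ scalerA.
apply: (annih_low char0 cubicF freeF (i := i)).
  by apply: ideal_sum_in => a0 _; apply/mpolyZ_in/annih_map.
apply/msize_leP => m m2; rewrite raddf_sum big1 //= => a0 _.
rewrite mcoeffZ mcoeff_map_mpoly mcoeffB (dhomog_nemf_coeff (l'_homog a0 t)); last first.
  by rewrite gtn_eqF // (leq_trans D2).
rewrite sub0r raddf_sum big1 => [|u _]; first by rewrite oppr0 raddf0 mulr0.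
rewrite /= mcoeffZ mcoeff_mderiv (dhomog_nemf_coeff (q_homog t)).
  by rewrite mul0rn mulr0.
by rewrite /= mdegD mdeg1 addn1 gtn_eqF.
Qed.

(** Degree -2: a constant vector field takes quadrics to linear forms, so it
    takes constant values on them only if they vanish. *)
Lemma syzygy_const_ring (e : 'I_b0 -> A) :
  (forall j, \sum_t e t *: map_mpoly i (s j t) = 0) -> forall t, e t = 0.
Proof.
move=> e0; have [||j|w wE t] := @syzygy_hom_ring 0 (fun t => (e t)%:MP) _ _ _ => //.
- by move=> t; rewrite -alg_mpolyC rpredZ ?dhomog1.
- rewrite (eq_bigr (fun t => e t *: map_mpoly i (s j t))) ?e0 ?ideal0 // => t _.
  by rewrite mulrC mul_mpolyC.
have := congr1 (mcoeff 0%MM) (wE t); rewrite mcoeffC eqxx mulr1 => ->.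
rewrite raddf_sum big1 //= => c _; rewrite mcoeffZ mcoeff_map_mpoly mcoeff_mderiv.
rewrite (dhomog_nemf_coeff (q_homog t)) ?mul0rn ?raddf0 ?mulr0 //.
by rewrite /= mdegD mdeg0 mdeg1.
Qed.

(** A vector field over [A] killing the generators is a combination of vector
    fields over [k] preserving [perp F]. *)
Lemma field_ring_free (w : 'I_n -> A) :
  (forall t, \sum_c w c *: map_mpoly i (q t 0)^`M(c) = 0) -> forall c, w c = 0.
Proof.
move=> w0 c.
have [t|P [P0 wE]] := @annih_descent _ _ _ char0 cubicF freeF _ i _ 'I_b0
  (fun c t => (q t 0)^`M(c)) w.
  by rewrite w0 ideal0.
rewrite wE big1 // => c0 _; rewrite [P c0 c](_ : _ = 0) ?rmorph0 ?mulr0 //.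
move: c; apply: (field_preserving_perp char0 cubicF freeF) => f /q_gen[a ->].
rewrite mxE; under eq_bigr do rewrite [mderiv _ _]raddf_sum scaler_sumr.
rewrite exchange_big; apply: ideal_sum_in => t _ /=.
under eq_bigr do rewrite mderivM scalerDr.
rewrite big_split /=; apply: (@idealD _ (perp F)).
  apply: ideal_sum_in => c _; apply/mpolyZ_in/idealM.
  exact: (q_perp q_gen).
under eq_bigr do rewrite scalerAr; rewrite -mulr_sumr.
exact: (@idealM _ (perp F)).
Qed.

End BaseRingTangents.

(** * Ideals with given leading forms *)

(** [I0] is the ideal of leading forms of [U], each leading form being attained
    in its own degree. *)
Definition has_leading_forms n (A : comNzRingType) (U I0 : ideal {mpoly A[n]}) : Prop :=
  (forall P d, P \in U -> (msize P <= d.+1)%N -> pihomog mdeg d P \in I0) /\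
  (forall f d, f \in I0 -> f \is d.-homog ->
    exists P, [/\ P \in U, (msize P <= d.+1)%N & pihomog mdeg d P = f]).

Lemma leading_forms_shift n (A : comNzRingType) (U I0 : ideal {mpoly A[n]}) w :
  has_leading_forms U I0 -> has_leading_forms (ideal_preim (shift w) U) I0.
Proof.
move=> [lead_in lead_lift]; split=> [P d|f d fI f_hom].
  rewrite mem_ideal_preim => PU Pd; rewrite -(pihomog_shift w Pd).
  by apply: lead_in => //; apply: msize_shift.
have [P [PU Pd Pf]] := lead_lift f d fI f_hom.
exists (shift (fun l => - w l) P); rewrite mem_ideal_preim /= shiftKV.
by rewrite msize_shift // pihomog_shift.
Qed.

Section Structure.
Variables (k : fieldType) (n : nat) (F : {mpoly k[n]}).
Hypothesis char0 : [pchar k] =i pred0.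
Hypothesis cubicF : F \is 3.-homog.
Hypothesis freeF : derivs_free F.
Variables (A : comNzRingType) (i : {rmorphism k -> A}).
Implicit Types U : ideal {mpoly A[n]}.
Local Notation I0 := (residual F i (fun=> 0)).

Lemma residual0_annih p : p \in I0 -> contract F i p = 0 -> p \in annih F i.
Proof. by move=> /residualP pE p0; apply/annihP => g; rewrite pE p0 mul0r. Qed.

Lemma leading_forms_low U P :
  has_leading_forms U I0 -> P \in U -> (msize P <= 2)%N -> P = 0.
Proof.
move=> [lead_in _] PU P2.
have lead0 Q d : Q \in U -> (msize Q <= d.+1)%N -> (d < 2)%N -> pihomog mdeg d Q = 0.
  move=> QU Qd d2; have Qd_low : (msize (pihomog mdeg d Q) <= d.+1)%N.
    apply/msize_leP => m dm; rewrite mcoeff_pihomog.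
    by case: eqP => // md; rewrite -md ltnn in dm.
  apply: (annih_low char0 cubicF freeF (i := i)); last by apply: leq_trans Qd_low _.
  apply: residual0_annih; first exact: lead_in.
  by apply: contract_msize => //; apply: leq_trans Qd_low _; rewrite ltnS ltnW.
have P1 : (msize P <= 1)%N.
  apply/msize_leP => m; rewrite leq_eqVlt => /orP[/eqP m1|m2].
    have := congr1 (mcoeff m) (lead0 P 1%N PU P2 isT).
    by rewrite mcoeff_pihomog -m1 eqxx mcoeff0.
  by move/msize_leP: P2; apply.
apply/mpolyP => m; rewrite mcoeff0; have [m0|m0] := eqVneq (mdeg m) 0%N.
  have := congr1 (mcoeff m) (lead0 P 0%N PU P1 isT).
  by rewrite mcoeff_pihomog m0 eqxx mcoeff0.
by move/msize_leP: P1; apply; rewrite lt0n.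
Qed.

(** Once [U] contains [perp F], its image in the Gorenstein quotient is the
    line spanned by a lift of the socle; the variables act on this line by
    scalars, which are the coordinates of the sought point. *)
Lemma leading_forms_residual U : has_leading_forms U I0 ->
  (forall f, f \in perp F -> map_mpoly i f \in U) ->
  exists a, zero_of F i a /\ U =i residual F i a.
Proof.
move=> leadU FU; have [lead_in lead_lift] := leadU.
have annihU : {subset annih F i <= U}.
  by move=> p; rewrite -(base_change_perp char0 cubicF freeF); apply: base_change_min.
have [b [s bsP]] := exists_dual_bases char0 cubicF freeF.
have [_ _ s_hom s1] := bsP.
pose sA := map_mpoly i s.
have sA_hom : sA \is 3.-homog by apply: dhomog_map.
have sA1 : contract F i sA = 1 by rewrite (contract_map F (i := idfun)) // s1 rmorph1.
have socle_mul g : contract F i (sA * g) = g@_0%MM.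
  rewrite -[g](subrK (g@_0%MM)%:MP) mulrDr contractD [sA * _%:MP]mulrC.
  rewrite mul_mpolyC contractZ sA1 mulr1 (contract_no3 cubicF) ?add0r.
    by rewrite mcoeffD mcoeffB mcoeffC eqxx mulr1 subrr add0r.
  move=> m m3; apply/memN_msupp_eq0/negP => /msuppM_le.
  move=> /allpairsP[[m1 m2] /= [/(dhomogP _ _ _ sA_hom)/= dm1 + mE]].
  have /eqP : (mdeg m1 + mdeg m2 = 3)%N by rewrite -mdegD -mE.
  rewrite dm1 (eqn_add2l 3 _ 0) mdeg_eq0 => /eqP ->.
  by rewrite mcoeff_msupp mcoeffB mcoeffC eqxx mulr1 subrr eqxx.
have sI : sA \in I0.
  by apply/residualP => g; rewrite socle_mul sA1 mul1r meval_at0.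
have [t [tU t4 tE]] := lead_lift sA 3%N sI sA_hom.
have contract_lead P : (msize P <= 4)%N -> contract F i P = contract F i (pihomog mdeg 3 P).
  move=> P4; apply/eqP; rewrite -subr_eq0 -contractB; apply/eqP.
  by apply: (contract_no3 cubicF) => m m3; rewrite mcoeffB mcoeff_pihomog m3 eqxx subrr.
have t1 : contract F i t = 1 by rewrite contract_lead // tE.
(* Subtracting a multiple of [t] and an element of [perp F] cancels the leading
   form, so the degree drops. *)
have line P : P \in U -> P - contract F i P *: t \in annih F i.
  have [d] := ubnP (msize P); elim: d P => // d IHd P; rewrite ltnS => Pd PU.
  case: d Pd IHd => [|d] Pd IHd.
    move: Pd; rewrite leqn0 msize_poly_eq0 => /eqP ->.
    by rewrite contract0 scale0r subrr ideal0.
  pose Q := pihomog mdeg d P; pose c := contract F i Q.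
  have QI : Q \in I0 by apply: lead_in.
  have QcN : Q - c *: sA \in annih F i.
    apply: residual0_annih; first by rewrite idealB // mpolyZ_in.
    by rewrite contractB contractZ sA1 mulr1 subrr.
  have cP : d != 3%N -> c = 0.
    by move=> d3; apply: (contract_dhomog cubicF _ (pihomogP mdeg d P)).
  pose P' := P - c *: t - (Q - c *: sA).
  have P'U : P' \in U.
    by apply: idealB; [apply: idealB => //; apply: mpolyZ_in | apply: annihU].
  have Q_size : (msize Q <= d.+1)%N.
    apply/msize_leP => m dm; rewrite mcoeff_pihomog.
    by case: eqP => // md; rewrite -md ltnn in dm.
  have P'd : (msize P' <= d)%N.
    apply/msize_leP => m; rewrite leq_eqVlt => /orP[/eqP md|md].
      rewrite /P' !mcoeffB !mcoeffZ [Q@_m]mcoeff_pihomog -md eqxx -tE.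
      have [d3|/cP ->] := eqVneq d 3%N; last by rewrite !mul0r !subr0 subrr.
      by rewrite mcoeff_pihomog -md d3 eqxx subrr.
    rewrite /P' !mcoeffB !mcoeffZ.
    have /msize_leP -> // := Pd; have /msize_leP -> // := Q_size.
    have [d3|/cP ->] := eqVneq d 3%N; last by rewrite !mul0r !subr0.
    have /msize_leP -> := t4; last by rewrite -[4%N]/(3.+1) -d3.
    rewrite (dhomog_nemf_coeff sA_hom); last by rewrite /= gtn_eqF // -d3.
    by rewrite mulr0 !subr0.
  have := IHd P' _ P'U; rewrite ltnS => /(_ P'd) P'N.
  have NQ : contract F i (Q - c *: sA) = 0.
    by move/annihP: QcN => /(_ 1); rewrite mulr1.
  have -> : P - contract F i P *: t = (P' - contract F i P' *: t) + (Q - c *: sA).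
    rewrite /P' contractB NQ subr0 contractB contractZ t1 mulr1 scalerBl.
    by ring.
  exact: idealD.
pose a l := contract F i ('X_l * t).
have tX g l : contract F i (('X_l * t) * g) = a l * contract F i (t * g).
  have /annihP/(_ g) : 'X_l * t - a l *: t \in annih F i.
    by apply: line; rewrite idealM.
  rewrite mulrBl contractB -scalerAl contractZ => /eqP.
  by rewrite subr_eq0 => /eqP.
have tXm m : contract F i (t * 'X_[m]) = 'X_[m].@[a].
  rewrite mpolyXE_id.
  have tpow l e g : contract F i (t * ('X_l ^+ e * g)) = a l ^+ e * contract F i (t * g).
    elim: e => [|e IHe]; first by rewrite !expr0 !mul1r.
    have -> : t * ('X_l ^+ e.+1 * g) = ('X_l * t) * ('X_l ^+ e * g).
      by rewrite exprS; ring.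
    by rewrite tX IHe exprS mulrA.
  have tprod (r : seq 'I_n) : contract F i (t * \prod_(l <- r) 'X_l ^+ m l)
      = \prod_(l <- r) a l ^+ m l.
    by elim: r => [|l r IHr]; rewrite ?big_nil ?mulr1 // !big_cons tpow IHr.
  rewrite tprod rmorph_prod; apply: eq_bigr => l _.
  by rewrite rmorphXn /= mevalXU.
have tg g : contract F i (t * g) = g.@[a].
  rewrite [g]mpolyE mulr_sumr contract_sum rmorph_sum; apply: eq_bigr => m _.
  by rewrite -scalerAr contractZ tXm /= mevalZ.
exists a; split=> [f fF|p].
  by rewrite -tg mulrC; have /annihP -> := annih_map char0 i fF.
apply/idP/idP => [pU|/residualP pE].
  apply/residualP => g; have /annihP/(_ g) := line p pU.
  by rewrite mulrBl contractB -scalerAl contractZ tg => /eqP; rewrite subr_eq0 => /eqP.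
rewrite -[p](subrK (contract F i p *: t)) idealD ?mpolyZ_in // annihU //.
by apply/annihP => g; rewrite mulrBl contractB pE -scalerAl contractZ tg subrr.
Qed.

Hypothesis tangentF : dim_hom_neg (perp F) n.
Variables (b0 b1 : nat).
Hypothesis resF : resolution_starts (perp F) b0 b1.

(** The corrections of degree 1 to the quadrics of [perp F] form a tangent vector of
    degree -1, which a translation removes; the remaining constants form one
    of degree -2, which is zero. *)
Lemma leading_forms_spike U : has_leading_forms U I0 ->
  exists a v, zero_of F i a /\ U =i spike F i a v.
Proof.
have [q [s [[q_hom s_hom] q_gen q_syz _ _]]] := resF.
move=> leadU; have [lead_in lead_lift] := leadU.
pose qA t := map_mpoly i (q t 0); pose sA j t := map_mpoly i (s j t).
have qA_hom t : qA t \is 2.-homog by apply: dhomog_map.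
have sqA j : \sum_t sA j t * qA t = 0.
  have := congr1 (map_mpoly i) (syz_rel q_syz j).
  rewrite rmorph0 rmorph_sum => sq0; rewrite -[RHS]sq0.
  by apply: eq_bigr => t _; rewrite /= rmorphM.
have qI t : qA t \in I0.
  by apply/annih_residual/annih_map => //; apply: (q_perp q_gen).
have [Q QP] := choice (fun t => lead_lift _ 2%N (qI t) (qA_hom t)).
pose l t := pihomog mdeg 1 (Q t); pose c t := (Q t)@_0%MM.
have QE t : Q t = qA t + l t + (c t)%:MP.
  have [_ Q3 QqA] := QP t; rewrite -QqA.
  rewrite {1}(pihomog_partitionE Q3) !big_ord_recl big_ord0 addr0 /=.
  rewrite addrC [X in X + _]addrC; congr (_ + _ + _).
  apply/mpolyP => m; rewrite mcoeff_pihomog mcoeffC mdeg_eq0 eq_sym.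
  by case: eqP => [<-|_]; rewrite ?mulr1 ?mulr0.
have SE j : \sum_t sA j t * Q t = \sum_t sA j t * l t + \sum_t c t *: sA j t.
  rewrite -[RHS]add0r -[X in _ = X + _](sqA j) -!big_split; apply: eq_bigr => t _ /=.
  by rewrite QE !mulrDr -addrA [sA j t * _%:MP]mulrC mul_mpolyC.
have sA_hom j t : sA j t \is 1.-homog by apply: dhomog_map.
have l_hom t : l t \is 1.-homog by apply: pihomogP.
have sl_hom j : \sum_t sA j t * l t \is 2.-homog.
  by apply: rpred_sum => t _; apply: dhomogM (sA_hom j t) (l_hom t).
have cs_hom j : \sum_t c t *: sA j t \is 1.-homog.
  by apply: rpred_sum => t _; apply: rpredZ.
have l_syz j : \sum_t sA j t * l t \in annih F i.
  apply: residual0_annih; last exact: (contract_dhomog cubicF _ (sl_hom j)).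
  have <- : pihomog mdeg 2 (\sum_t sA j t * Q t) = \sum_t sA j t * l t.
    by rewrite SE raddfD /= pihomog_dE // (pihomog_ne0 _ (cs_hom j)) // addr0.
  apply: lead_in.
    by apply: ideal_sum_in => t _; apply: idealM; case: (QP t).
  apply/msize_leP => m m3; rewrite SE mcoeffD.
  rewrite (dhomog_nemf_coeff (sl_hom j)) ?(dhomog_nemf_coeff (cs_hom j)) ?addr0 //.
    by rewrite /= gtn_eqF // (leq_trans _ m3).
  by rewrite /= gtn_eqF.
have [w wE] := syzygy_hom_ring char0 cubicF freeF tangentF q_hom q_gen q_syz
  (isT : (1 < 2)%N) l_hom l_syz.
have qA_shift t : shift w (qA t) = qA t + l t + ((qA t).@[w])%:MP.
  rewrite shift_quadric // wE; congr (_ + _ + _); apply: eq_bigr => u _.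
  congr (_ *: _); apply/mpolyP => m.
  by rewrite mcoeff_mderiv !mcoeff_map_mpoly mcoeff_mderiv raddfMn.
pose U' := ideal_preim (shift w) U.
have leadU' : has_leading_forms U' I0 by apply: leading_forms_shift.
pose e t := c t - (qA t).@[w].
have QU' t : qA t + (e t)%:MP \in U'.
  rewrite mem_ideal_preim rmorphD /= shiftC qA_shift -addrA -mpolyCD.
  have -> : (qA t).@[w] + e t = c t by rewrite addrC subrK.
  by rewrite -QE; case: (QP t).
have e0 : forall t, e t = 0.
  apply: (syzygy_const_ring char0 cubicF freeF tangentF q_hom q_gen q_syz (i := i)) => j.
  apply: (leading_forms_low leadU').
    have -> : \sum_t e t *: map_mpoly i (s j t) = \sum_t sA j t * (qA t + (e t)%:MP).
      rewrite -[LHS]add0r -[X in X + _ = _](sqA j) -big_split; apply: eq_bigr => t _ /=.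
      by rewrite mulrDr [sA j t * _%:MP]mulrC mul_mpolyC.
    by apply: ideal_sum_in => t _; apply: idealM.
  apply/msize_leP => m m2; rewrite raddf_sum big1 // => t _ /=.
  by rewrite mcoeffZ (dhomog_nemf_coeff (sA_hom j t)) ?mulr0 //= gtn_eqF.
have FU' f : f \in perp F -> map_mpoly i f \in U'.
  move=> /q_gen[a ->]; rewrite mxE [map_mpoly i _]rmorph_sum.
  apply: ideal_sum_in => t _; rewrite rmorphM; apply: idealM.
  by have := QU' t; rewrite e0 mpolyC0 addr0.
have [a [a0 U'E]] := leading_forms_residual leadU' FU'.
exists a, (fun l => - w l); split=> // p.
by rewrite spikeE -U'E mem_ideal_preim /= shiftKV.
Qed.

End Structure.

(** * The isomorphism *)

Section EqSpike.
Variables (k : fieldType) (n : nat) (F : {mpoly k[n]}).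

Lemma eq_spike (A : comNzRingType) (i : {rmorphism k -> A}) r r' v v' :
  r =1 r' -> v =1 v' -> spike F i r v =i spike F i r' v'.
Proof.
by move=> rr vv p; rewrite !spikeE (shift_ext _ vv) (eq_residual _ _ rr).
Qed.

End EqSpike.

Section Points.
Variables (k : fieldType) (n : nat) (K : ideal {mpoly k[n]}) (A : kalg k).

Definition point_coord (f : Spec_quot_point K A) (l : 'I_n) : A := f (proj K 'X_l).

Lemma point_eval (f : Spec_quot_point K A) p :
  f (proj K p) = (map_mpoly (kalg_str A) p).@[point_coord f].
Proof.
apply: (@eq_mpoly_rmorph _ _ _ (f \o proj K)
  (meval (point_coord f) \o map_mpoly (kalg_str A))) => [c|l] /=.
  by rewrite map_mpolyC mevalC; apply: (spec_morK f c).
by rewrite map_mpolyX mevalXU.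
Qed.

Lemma eq_point (f f' : Spec_quot_point K A) :
  point_coord f =1 point_coord f' -> f =1 f'.
Proof.
by move=> ff' x; rewrite -[x]lift_quotK !point_eval; apply: meval_eq.
Qed.

Lemma exists_point (a : 'I_n -> A) :
  (forall f, f \in K -> (map_mpoly (kalg_str A) f).@[a] = 0) ->
  exists f : Spec_quot_point K A, point_coord f =1 a.
Proof.
move=> a0; pose e p := (map_mpoly (kalg_str A) p).@[a].
pose h (x : quot K) : A := e (lift_quot x).
have hE p : h (proj K p) = e p.
  apply/eqP; rewrite -subr_eq0 /h.
  have -> : e (lift_quot (proj K p)) - e p = e (lift_quot (proj K p) - p).
    by rewrite /e !rmorphB.
  by rewrite /e a0 // -projE lift_quotK.
have h_add : zmod_morphism h.
  move=> x y; rewrite -[x]lift_quotK -[y]lift_quotK -rmorphB !hE.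
  by rewrite /e !rmorphB.
have h_mul : monoid_morphism h.
  split=> [|x y]; first by rewrite -(rmorph1 (proj K)) hE /e !rmorph1.
  rewrite -[x]lift_quotK -[y]lift_quotK -rmorphM !hE.
  by rewrite /e !rmorphM.
pose hR : {rmorphism quot K -> A} := HB.pack h
  (GRing.isZmodMorphism.Build _ _ h h_add) (GRing.isMonoidMorphism.Build _ _ h h_mul).
have hK c : hR (str K c) = kalg_str A c.
  by rewrite /= /str hE /e map_mpolyC mevalC.
exists (SpecQuotPoint hK) => l.
by rewrite /point_coord /= hE /e map_mpolyX mevalXU.
Qed.

End Points.

Section Main.
Variables (k : fieldType) (n : nat) (F : {mpoly k[n]}).
Hypothesis char0 : [pchar k] =i pred0.
Hypothesis cubicF : F \is 3.-homog.
Hypothesis freeF : derivs_free F.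
Hypothesis tangentF : dim_hom_neg (perp F) n.
Variables (b0 b1 : nat).
Hypothesis resF : resolution_starts (perp F) b0 b1.

Local Notation d := (1 + (n + n))%N.
Local Notation I := (ideal_sum (perp F) (Sge k n 3)).

Let d_neq0 : d%:R != 0 :> k.
Proof. exact: nat_neq0. Qed.

(** Moving one translate onto the other by [w], the quadrics of [perp F] change by
    the derivative along [w] up to constants; no nonzero polynomial of degree
    at most 1 lies in the residual ideal, so the constant vector field [w] kills
    these quadrics. *)
Lemma spike_translation_unique (A : comNzRingType) (i : {rmorphism k -> A})
    a v a' v' : spike F i a v =i spike F i a' v' -> v =1 v'.
Proof.
move=> vv'; have [q [s [[q_hom s_hom] q_gen q_syz _ _]]] := resF.
pose w l := v' l - v l; suff w0 : forall l, w l = 0.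
  by move=> l; apply/esym/eqP; rewrite -subr_eq0; apply/eqP; apply: w0.
apply: (field_ring_free char0 cubicF freeF q_gen (i := i)) => t.
set qA := map_mpoly i (q t 0).
have qA_hom : qA \is 2.-homog by apply: dhomog_map.
have qN : qA \in annih F i by apply/annih_map => //; apply: (q_perp q_gen).
pose D := \sum_l w l *: map_mpoly i (q t 0)^`M(l).
have D_hom : D \is 1.-homog.
  apply: rpred_sum => l _; apply/rpredZ/dhomog_map/dhomogP => m.
  rewrite mcoeff_msupp mcoeff_mderiv => mq.
  have /(dhomogP _ _ _ (q_hom t))/= : (m + U_(l))%MM \in msupp (q t 0).
    by rewrite mcoeff_msupp; apply: contraNneq mq => ->; rewrite mul0rn.
  by rewrite mdegD mdeg1 addn1 => -[].
have shiftq : shift w qA = qA + D + (qA.@[w])%:MP.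
  rewrite shift_quadric //; congr (_ + _ + _); apply: eq_bigr => l _.
  congr (_ *: _); apply/mpolyP => m.
  by rewrite mcoeff_mderiv !mcoeff_map_mpoly mcoeff_mderiv raddfMn.
have L2 : (msize (D + (qA.@[w])%:MP) <= 2)%N.
  apply/msize_leP => m m2; rewrite mcoeffD (dhomog_nemf_coeff D_hom); last first.
    by rewrite /= gtn_eqF.
  by rewrite mcoeffC -mdeg_eq0 gtn_eqF ?mulr0 ?addr0 // ltnW.
have LR : D + (qA.@[w])%:MP \in residual F i a'.
  have -> : D + (qA.@[w])%:MP = shift w qA - qA.
    by rewrite shiftq; ring.
  apply: idealB; last exact: annih_residual.
  have -> : shift w qA = shift v' (shift (fun l => - v l) qA).
    by rewrite shift_shift; apply: shift_ext => l; rewrite addrC.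
  rewrite -spikeE -vv' spikeE shiftKV; exact: annih_residual.
have LN : D + (qA.@[w])%:MP \in annih F i.
  have L0 : contract F i (D + (qA.@[w])%:MP) = 0.
    by apply: contract_msize => //; apply: leqW.
  by apply/annihP => g; move/residualP: LR => ->; rewrite L0 mul0r.
have L0 := annih_low char0 cubicF freeF LN L2.
apply/mpolyP => m; rewrite mcoeff0 -/D.
have [m1|m1] := eqVneq (mdeg m) 1%N; last exact: dhomog_nemf_coeff D_hom m1.
have := congr1 (mcoeff m) L0; rewrite mcoeffD mcoeffC -mdeg_eq0 m1.
by rewrite mulr0 addr0 mcoeff0.
Qed.

Section Family.
Variables (A : kalg k) (f : Spec_quot_point (perp F) A).

Let a := point_coord f.
Let iX : {rmorphism k -> {poly A}} := polyC \o kalg_str A.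

(** On the residual quotient of the point [t a] the trace of [alpha_l] is
    [- t a_l]; the translation by [t a / d] brings the barycenter back to 0. *)
Definition spike_family : ideal {mpoly {poly A}[n]} :=
  spike F iX (fun l => 'X * (a l)%:P) (fun l => 'X * (kalg_str A d%:R^-1 * a l)%:P).

Let a_zero : zero_of F (kalg_str A) a.
Proof.
move=> g; rewrite -mem_proj0 -point_eval => /eqP ->.
exact: rmorph0.
Qed.

Let aX_zero : zero_of F iX (fun l => 'X * (a l)%:P).
Proof.
apply: zero_of_scale => //.
by apply: (zero_of_map (g := polyC : {rmorphism A -> {poly A}}) _ _ a_zero).
Qed.

Lemma base_change_family (B : comNzRingType) (g : {rmorphism {poly A} -> B})
    (j : {rmorphism k -> B}) r v :
  (forall c, j c = g (kalg_str A c)%:P) ->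
  (forall l, r l = g 'X * g (a l)%:P) ->
  (forall l, v l = j d%:R^-1 * r l) ->
  base_change g spike_family =i spike F j r v.
Proof.
move=> jE rE vE; apply: base_change_spike => // l; first by rewrite rE rmorphM.
by rewrite vE rE jE !rmorphM /= mulrCA.
Qed.

Lemma family_at_one : base_change (at_one A) spike_family
  =i spike F (kalg_str A) a (fun l => kalg_str A d%:R^-1 * a l).
Proof.
by apply: base_change_family => [c|l|l] //=;
  rewrite /horner_eval !hornerE ?mul1r.
Qed.

Let family_basis (B : comNzRingType) (g : {rmorphism {poly A} -> B}) :
  exists e : 'I_d -> quot (base_change g spike_family),
    is_basis (str (base_change g spike_family)) e /\
    forall j (M : 'M[B]_d),
      (forall x, proj (base_change g spike_family) 'X_j * e x
        = \sum_y str (base_change g spike_family) (M x y) * e y) ->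
      \tr M = 0.
Proof.
have [b [s bsP]] := exists_dual_bases char0 cubicF freeF.
pose j : {rmorphism k -> B} := g \o iX.
pose r l := g ('X * (a l)%:P).
have r_zero : zero_of F j r by apply: (zero_of_map (g := g) _ _ aX_zero).
have famE : base_change g spike_family =i spike F j r (fun l => j d%:R^-1 * r l).
  by apply: base_change_family => // l; rewrite /r rmorphM.
exists (spike_basis j (fun l => j d%:R^-1 * r l) b (base_change g spike_family)); split.
  exact: (spike_basisP char0 cubicF freeF r_zero bsP famE).
move=> u M ME.
rewrite (spike_trace char0 cubicF freeF r_zero bsP famE ME) mulrA.
by rewrite -(rmorph_nat j) -rmorphM mulfV ?d_neq0 // rmorph1 mul1r subrr.
Qed.

Lemma family_hilb_point : hilb_point d spike_family.
Proof.
have [b [s bsP]] := exists_dual_bases char0 cubicF freeF.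
have eP := spike_basisP char0 cubicF freeF aX_zero bsP
  (fun p => erefl (p \in spike_family)).
split=> [||K g].
- exact: (basis_finite (phi := strM spike_family) eP).
- exact: (basis_flat (phi := strM spike_family) eP).
by have [e [gP _]] := family_basis g; exists e.
Qed.

Lemma family_barycenter : is_barycenter d (A := kalg_poly A) spike_family (fun=> 0).
Proof.
move=> B g e eP j M ME; rewrite rmorph0.
have [e' [e'P tr0]] := family_basis g.
have [M' M'E] := choice (fun x => e'P.1 (proj (base_change g spike_family) 'X_j * e' x)).
rewrite (trace_basis_indep (phi := strM (base_change g spike_family)) (e' := e')
  (M' := \matrix_(x, y) M' x y) eP e'P ME) => [|x].
  rewrite (tr0 j) ?mulr0 // => x; rewrite M'E.
  by apply: eq_bigr => y _; rewrite mxE.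
by rewrite M'E; apply: eq_bigr => y _; rewrite mxE.
Qed.

Lemma family_equivariant : Gm_equivariant spike_family.
Proof.
move=> B c c' h h' cc' hC hX p.
pose j : {rmorphism k -> B} := h \o iX.
pose r l := h ('X * (a l)%:P).
have famE : base_change h spike_family =i spike F j r (fun l => j d%:R^-1 * r l).
  by apply: base_change_family => // l; rewrite /r rmorphM.
rewrite mem_Gm_act famE -mem_Gm_act.
pose r' l := c * r l; pose v' l := c * (j d%:R^-1 * r l).
rewrite -(Gm_act_spike cubicF j cc' (r' := r') (v' := v')) //.
apply: base_change_family => [e|l|l].
- by rewrite hC.
- by rewrite hX hC /r' /r rmorphM mulrA.
exact: mulrCA.
Qed.

Lemma family_at_zero :
  base_change (at_zero A) spike_family =i base_change (kalg_str A) I.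
Proof.
move=> p; rewrite (base_change_top_degree char0 cubicF freeF).
rewrite (base_change_family (j := kalg_str A) (r := fun=> 0) (v := fun=> 0)).
- by rewrite spikeE shift0.
- by move=> c; rewrite /= /horner_eval hornerC.
- by move=> l; rewrite /= /horner_eval hornerX mul0r.
by move=> l; rewrite mulr0.
Qed.

Lemma family_in_spike : negative_spike_point d I spike_family.
Proof.
split; [split | exact: family_equivariant | exact: family_at_zero].
  exact: family_hilb_point.
exact: family_barycenter.
Qed.

End Family.

Lemma spike_torsion_free (A : kalg k) (J : ideal {mpoly {poly A}[n]}) e p :
  negative_spike_point d I J -> 'X^e *: p \in J -> p \in J.
Proof.
move=> [[[_ flatJ _] _] _ _]; apply: flat_torsion_free => //.
apply: lreg_lead; rewrite lead_coefXn; exact: lreg1.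
Qed.

(** A point of the spike can be recovered from its fibre over 1. *)
Lemma spike_determined (A : kalg k) (J J' : ideal {mpoly {poly A}[n]}) :
  negative_spike_point d I J -> negative_spike_point d I J' ->
  base_change (at_one A) J =i base_change (at_one A) J' -> J =i J'.
Proof.
move=> JP J'P JJ' p; have [_ eqJ _] := JP; have [_ eqJ' _] := J'P.
apply/idP/idP; apply: (equivariant_determined (kalg_str A) char0) => //.
- by move=> e q; apply: spike_torsion_free.
- by move=> q; rewrite JJ'.
- by move=> e q; apply: spike_torsion_free.
by move=> q; rewrite JJ'.
Qed.

Lemma family_inj (A : kalg k) (f f' : Spec_quot_point (perp F) A) :
  spike_family f =i spike_family f' <-> f =1 f'.
Proof.
split=> [ff'|ff' p].
  apply: eq_point => l.
  have := eq_base_change (at_one A) ff' => E.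
  have /spike_translation_unique/(_ l) : spike F (kalg_str A) (point_coord f)
      (fun l => kalg_str A d%:R^-1 * point_coord f l)
    =i spike F (kalg_str A) (point_coord f')
      (fun l => kalg_str A d%:R^-1 * point_coord f' l).
    by move=> p; rewrite -!family_at_one E.
  move=> /(congr1 (fun x => kalg_str A d%:R * x)).
  by rewrite !mulrA -!rmorphM mulfV ?d_neq0 // rmorph1 !mul1r.
by apply: eq_spike => l; rewrite /point_coord ff'.
Qed.

(** The fibre over 1 is a translate of the residual ideal of some point; the
    barycenter, computed on this fibre, determines the translation. *)
Lemma family_surj (A : kalg k) (J : ideal {mpoly {poly A}[n]}) :
  negative_spike_point d I J ->
  exists f : Spec_quot_point (perp F) A, spike_family f =i J.
Proof.
move=> JP; have [[hilbJ barJ] eqJ J0] := JP.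
have tfJ e p : 'X^e *: p \in J -> p \in J by apply: spike_torsion_free.
have I0E := base_change_top_degree char0 cubicF freeF (kalg_str A).
have lead : has_leading_forms (base_change (at_one A) J)
    (residual F (kalg_str A) (fun=> 0)).
  split=> [P e PU Pe|g e].
    by rewrite -I0E -J0; apply: (top_degree_in (kalg_str A) char0).
  by rewrite -I0E -J0; apply: (top_degree_lift (kalg_str A) char0).
have [a [v [a0 UE]]] := leading_forms_spike char0 cubicF freeF tangentF resF lead.
have [b [s bsP]] := exists_dual_bases char0 cubicF freeF.
have eP := spike_basisP char0 cubicF freeF a0 bsP UE.
have vE l : v l = kalg_str A d%:R^-1 * a l.
  have [M ME] := choice (fun x => eP.1 (proj _ 'X_l * spike_basis (kalg_str A) v b _ x)).
  pose N : 'M[A]_d := \matrix_(x, y) M x y.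
  have NE x : proj (base_change (at_one A) J) 'X_l * spike_basis (kalg_str A) v b _ x
      = \sum_y str _ (N x y) * spike_basis (kalg_str A) v b _ y.
    by rewrite ME; apply: eq_bigr => y _; rewrite mxE.
  have := barJ _ (at_one A) _ eP l N NE.
  rewrite rmorph0 /= /horner_eval hornerC.
  rewrite (spike_trace char0 cubicF freeF a0 bsP UE NE) mulrBr mulrA.
  rewrite -(rmorph_nat (kalg_str A)) -rmorphM mulVf ?d_neq0 // rmorph1 mul1r.
  by move=> /esym/eqP; rewrite subr_eq0 => /eqP.
have [f fE] := exists_point a0; exists f.
apply: spike_determined JP _; first exact: family_in_spike.
move=> p; rewrite family_at_one UE; apply: eq_spike => // l.
by rewrite fE vE.
Qed.

Lemma family_natural (A B : kalg k) (g : {rmorphism A -> B}) : kalg_morph g ->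
  forall (f : Spec_quot_point (perp F) A) (f' : Spec_quot_point (perp F) B),
  f' =1 g \o f -> spike_family f' =i base_change (poly_map g) (spike_family f).
Proof.
move=> gk f f' ff' p; apply/esym; apply: base_change_family => [c|l|l].
- by rewrite /= map_polyC /= gk.
- by rewrite /= map_polyX map_polyC /point_coord ff'.
by rewrite /= polyCM mulrCA.
Qed.

Lemma spike_isomorphism : inhabited (Spec_iso_negative_spike d (perp F) I).
Proof.
split; apply: (@SpecIsoNegativeSpike k n d (perp F) I spike_family).
- exact: family_in_spike.
- exact: family_inj.
- exact: family_surj.
exact: family_natural.
Qed.

End Main.

Theorem theorem1p5 (k : closedFieldType) (char0 : [pchar k]%R =i pred0)
    (F : {mpoly k[6]}) (genF : general_enough F) :
  inhabited (@Spec_iso_negative_spike k 6 13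
               (perp F) (ideal_sum (perp F) (Sge k 6 3))).
Proof.
have [cubicF freeF resF tangentF] := genF.
exact: (spike_isomorphism char0 cubicF freeF tangentF resF).
Qed.
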